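(* Under the setting of $\min f(x)$ s.t. $g(x)\in K$ ($f,g$ twice continuously differentiable, $K$ closed, $C:=g^{-1}(K)$), let $d\in T_C(\bar x)$, let $\bar x$ be a local optimal solution in direction $d$, suppose $\nabla f(\bar x)d=0$ and MSCQ holds at $\bar x$ in direction $d$ for $g(x)\in K$. Then: (i) there exists $\lambda\in\Lambda(\bar x;d)$ such that $\hat\sigma_{T_K^{''}(g(\bar x);\nabla g(\bar x)d),A}(\lambda)\le0$ for every set $A\supseteq\Theta$; in particular $\hat\sigma_{T_K^{''}(g(\bar x);\nabla g(\bar x)d)}(\lambda)\le0$; (ii) if $T_K^2(g(\bar x);\nabla g(\bar x)d)\ne\emptyset$, there exists $\lambda\in\Lambda(\bar x;d)$ such that for every set $B\supseteq\Omega$, $\nabla^2_{xx}L(\bar x,\lambda)(d,d)-\hat\sigma_{T_K^2(g(\bar x);\nabla g(\bar x)d),B}(\lambda)\ge0$; in particular $\nabla^2_{xx}L(\bar x,\lambda)(d,d)-\hat\sigma_{T_K^2(g(\bar x);\nabla g(\bar x)d)}(\lambda)\ge0$.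
   Context: Lower generalized support function: for closed $S\subseteq\mathbb{R}^m$ and $A\subseteq\mathbb{R}^m$, if $S\ne\emptyset$, $\hat\sigma_{S,A}(\lambda):=\liminf_{\lambda'\to\lambda}\inf_u\{\langle\lambda',u\rangle\mid u\in A,\ \lambda'\in N_S(u)\}$ ($\inf\emptyset=+\infty$, $N_S$ limiting normal cone); if $S=\emptyset$, $\hat\sigma_{S,A}\equiv-\infty$; $\hat\sigma_S:=\hat\sigma_{S,\mathbb{R}^m}$. $L(x,\lambda):=f(x)+\langle\lambda,g(x)\rangle$; $\Lambda(\bar x;d):=\{\lambda\mid\lambda\in N_K(g(\bar x);\nabla g(\bar x)d),\ \nabla_xL(\bar x,\lambda)=0\}$ with directional limiting normal cone $N_K(\bar y;v):=\limsup_{t\downarrow0,v'\to v}\hat N_K(\bar y+tv')$. $\Theta:=\nabla g(\bar x)(T_C^{''}(\bar x;d))$, $\Omega:=\nabla g(\bar x)(T_C^2(\bar x;d))+\nabla^2g(\bar x)(d,d)$. $T_S^2(\bar y;v):=\{w\mid \exists t_k\downarrow0,w_k\to w,\ \bar y+t_kv+\tfrac12t_k^2w_k\in S\}$; $T_S^{''}(\bar y;v):=\{w\mid \exists(t_k,r_k)\downarrow(0,0),w_k\to w,\ t_k/r_k\to0,\ \bar y+t_kv+\tfrac12t_kr_kw_k\in S\}$. Local optimality in direction $d$: $f(x)\ge f(\bar x)$ on $C\cap(\bar x+V_{\rho,\delta}(d))$ for some $\rho,\delta>0$, $V_{\rho,\delta}(d):=\{w\in\delta B\mid\|\,\|d\|w-\|w\|d\,\|\le\rho\|w\|\|d\|\}$.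 MSCQ in direction $d$: $\mathrm{dist}(x,g^{-1}(K))\le\kappa\,\mathrm{dist}(g(x),K)$ on $\bar x+V_{\rho,\delta}(d)$ for some $\rho,\delta,\kappa>0$. *)

(* Defs.v *)
From HB Require Import structures.
From mathcomp Require Import all_boot all_order all_algebra.
From mathcomp Require Import all_classical all_reals all_analysis.
Set Implicit Arguments.
Unset Strict Implicit.
Unset Printing Implicit Defensive.
Import Order.TTheory GRing.Theory Num.Theory.
Import numFieldNormedType.Exports.
Local Open Scope classical_set_scope.
Local Open Scope ring_scope.

Section Defs.
Variable R : realType.

Definition dotv {k : nat} (u v : 'rV[R]_k) : R := \sum_(i < k) u 0 i * v 0 i.
Definition enorm {k : nat} (u : 'rV[R]_k) : R := Num.sqrt (dotv u u).

Definition edist {k : nat} (x : 'rV[R]_k) (S : set 'rV[R]_k) : R :=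
  inf [set enorm (x - y) | y in S].

Definition C2 {k l : nat} (F : 'rV[R]_k -> 'rV[R]_l) : Prop :=
  (forall x, differentiable F x) /\
  (forall v x, differentiable ('D_v F) x) /\
  (forall u v, continuous ('D_u ('D_v F))).
Definition C2R {k : nat} (F : 'rV[R]_k -> R) : Prop :=
  (forall x, differentiable F x) /\
  (forall v x, differentiable ('D_v F) x) /\
  (forall u v, continuous ('D_u ('D_v F))).

Definition tangent_cone {k : nat} (S : set 'rV[R]_k) (x : 'rV[R]_k) : set 'rV[R]_k :=
  [set d | exists (t : nat -> R) (dk : nat -> 'rV[R]_k),
     (forall j, 0 < t j) /\ t @ \oo --> (0 : R) /\ dk @ \oo --> d /\
     (forall j, S (x + t j *: dk j))].

Definition tangent2 {k : nat} (S : set 'rV[R]_k) (y v : 'rV[R]_k) : set 'rV[R]_k :=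
  [set w | exists (t : nat -> R) (wk : nat -> 'rV[R]_k),
     (forall j, 0 < t j) /\ t @ \oo --> (0 : R) /\ wk @ \oo --> w /\
     (forall j, S (y + t j *: v + (2^-1 * t j ^+ 2) *: wk j))].

Definition tangent2asym {k : nat} (S : set 'rV[R]_k) (y v : 'rV[R]_k) : set 'rV[R]_k :=
  [set w | exists (t r : nat -> R) (wk : nat -> 'rV[R]_k),
     (forall j, 0 < t j) /\ (forall j, 0 < r j) /\
     t @ \oo --> (0 : R) /\ r @ \oo --> (0 : R) /\
     (fun j => t j / r j) @ \oo --> (0 : R) /\ wk @ \oo --> w /\
     (forall j, S (y + t j *: v + (2^-1 * t j * r j) *: wk j))].

Definition reg_normal {k : nat} (S : set 'rV[R]_k) (y : 'rV[R]_k) : set 'rV[R]_k :=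
  [set v | S y /\ forall eps : R, 0 < eps -> exists2 del : R, 0 < del &
     forall y', S y' -> enorm (y' - y) < del -> dotv v (y' - y) <= eps * enorm (y' - y)].

Definition lim_normal {k : nat} (S : set 'rV[R]_k) (y : 'rV[R]_k) : set 'rV[R]_k :=
  [set v | exists (yk vk : nat -> 'rV[R]_k),
     yk @ \oo --> y /\ vk @ \oo --> v /\ (forall j, reg_normal S (yk j) (vk j))].

Definition dir_normal {k : nat} (S : set 'rV[R]_k) (y v : 'rV[R]_k) : set 'rV[R]_k :=
  [set lam | exists (t : nat -> R) (vk lk : nat -> 'rV[R]_k),
     (forall j, 0 < t j) /\ t @ \oo --> (0 : R) /\ vk @ \oo --> v /\
     lk @ \oo --> lam /\ (forall j, reg_normal S (y + t j *: vk j) (lk j))].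

Definition inner_inf {k : nat} (S A : set 'rV[R]_k) (lam' : 'rV[R]_k) : \bar R :=
  ereal_inf [set (dotv lam' u)%:E | u in A `&` [set u | lim_normal S u lam']].

Definition lsupport {k : nat} (S A : set 'rV[R]_k) (lam : 'rV[R]_k) : \bar R :=
  if pselect (S = set0) is left _ then -oo%E
  else ereal_sup [set ereal_inf [set inner_inf S A lam' | lam' in
                                   [set lam' | enorm (lam' - lam) < del]]
                 | del in [set del : R | 0 < del]].

Definition lsupport0 {k : nat} (S : set 'rV[R]_k) (lam : 'rV[R]_k) : \bar R :=
  lsupport S setT lam.

Definition dir_nbhd {k : nat} (rho del : R) (d : 'rV[R]_k) : set 'rV[R]_k :=
  [set w | enorm w <= del /\
           enorm (enorm d *: w - enorm w *: d) <= rho * enorm w * enorm d].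

Definition loc_opt_dir {n m : nat} (f : 'rV[R]_n -> R) (g : 'rV[R]_n -> 'rV[R]_m)
  (K : set 'rV[R]_m) (xb d : 'rV[R]_n) : Prop :=
  exists rho del : R, 0 < rho /\ 0 < del /\
    forall x, K (g x) -> dir_nbhd rho del d (x - xb) -> f xb <= f x.

Definition MSCQ_dir {n m : nat} (g : 'rV[R]_n -> 'rV[R]_m)
  (K : set 'rV[R]_m) (xb d : 'rV[R]_n) : Prop :=
  exists rho del kap : R, 0 < rho /\ 0 < del /\ 0 < kap /\
    forall x, dir_nbhd rho del d (x - xb) ->
      edist x (g @^-1` K) <= kap * edist (g x) K.

Definition lagr {n m : nat} (f : 'rV[R]_n -> R) (g : 'rV[R]_n -> 'rV[R]_m)
  (lam : 'rV[R]_m) : 'rV[R]_n -> R := fun x => f x + dotv lam (g x).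

(* Lambda(xb; d) : directional multipliers.  grad_x L(xb,lam) = 0 is stated
   as: every directional derivative of x |-> L(x,lam) at xb vanishes. *)
Definition mult_dir {n m : nat} (f : 'rV[R]_n -> R) (g : 'rV[R]_n -> 'rV[R]_m)
  (K : set 'rV[R]_m) (xb d : 'rV[R]_n) : set 'rV[R]_m :=
  [set lam | dir_normal K (g xb) ('D_d g xb) lam /\
             forall v : 'rV[R]_n, 'D_v (lagr f g lam) xb = 0].

End Defs.

(* Main.v *)
Require Import Defs.
From HB Require Import structures.
From mathcomp Require Import all_boot all_order all_algebra.
From mathcomp Require Import all_classical all_reals all_analysis.
From mathcomp Require Import ring lra.
Import Order.TTheory GRing.Theory Num.Theory.
Import numFieldNormedType.Exports.
Local Open Scope classical_set_scope.
Local Open Scope ring_scope.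
Set Implicit Arguments.
Unset Strict Implicit.
Unset Printing Implicit Defensive.

(** The second-order tangent sets [T''] and [T^2] are treated together as outer
    limits of [(S - y - t v) / (t r / 2)] as [t, r -> 0] with [t / r -> theta],
    where [theta] is [0] or [1].  A second-order expansion turns local
    optimality into [<f'(xb), w> + theta f''(xb)(d, d) >= 0] on the tangent set
    of [C], and turns directional metric subregularity into a global error
    bound for the system [g'(xb) w + theta g''(xb)(d, d) \in S], [S] being the
    tangent set of [K].

    The minimisation of [<f'(xb), w>] under this system need not have a
    solution, so one minimises
    [<f'(xb), w> + eps/2 |w|^2 + j/2 |g'(xb) w + h - u|^2] over [u \in S]
    instead.  The vectors [lam = j (g'(xb) w + h - u)] are proximal normals to
    [S] and the error bound keeps them bounded; letting [j -> oo] and then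
    [eps -> 0] yields the multiplier, the second limit being the reason why the
    lower limit appears in the generalized support function.  Finally, normals
    to an outer limit of sets are limits of normals to these sets, so the
    multiplier lies in the directional normal cone of [K]. *)

(** * Euclidean norm *)

Section Euclidean.
Context {R : realType} {k : nat}.
Implicit Types (u v w : 'rV[R]_k) (a : R).

Lemma dotvC u v : dotv u v = dotv v u.
Proof. by apply: eq_bigr => i _; rewrite mulrC. Qed.

Lemma dotvDl u v w : dotv (u + v) w = dotv u w + dotv v w.
Proof. by rewrite -big_split; apply: eq_bigr => i _; rewrite mxE mulrDl. Qed.

Lemma dotvZl a u v : dotv (a *: u) v = a * dotv u v.
Proof. by rewrite mulr_sumr; apply: eq_bigr => i _; rewrite mxE mulrA. Qed.

Lemma dotvDr u v w : dotv u (v + w) = dotv u v + dotv u w.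
Proof. by rewrite dotvC dotvDl !(dotvC u). Qed.

Lemma dotvZr a u v : dotv u (a *: v) = a * dotv u v.
Proof. by rewrite dotvC dotvZl dotvC. Qed.

Lemma dotvNl u v : dotv (- u) v = - dotv u v.
Proof. by rewrite -scaleN1r dotvZl mulN1r. Qed.

Lemma dotvNr u v : dotv u (- v) = - dotv u v.
Proof. by rewrite dotvC dotvNl dotvC. Qed.

Lemma dotvBl u v w : dotv (u - v) w = dotv u w - dotv v w.
Proof. by rewrite dotvDl dotvNl. Qed.

Lemma dotvBr u v w : dotv u (v - w) = dotv u v - dotv u w.
Proof. by rewrite dotvDr dotvNr. Qed.

Lemma dotv0r u : dotv u 0 = 0.
Proof. by rewrite -(scale0r u) dotvZr mul0r. Qed.

Definition dotvE := (dotvDl, dotvDr, dotvNl, dotvNr, dotvZl, dotvZr).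

Lemma dotvv_ge0 u : 0 <= dotv u u.
Proof. by apply: sumr_ge0 => i _; rewrite -expr2 sqr_ge0. Qed.

Lemma enorm_ge0 u : 0 <= enorm u.
Proof. exact: sqrtr_ge0. Qed.
#[local] Hint Resolve enorm_ge0 : core.

Lemma sqr_enorm u : enorm u ^+ 2 = dotv u u.
Proof. by rewrite sqr_sqrtr // dotvv_ge0. Qed.

Lemma normr_coord_le_enorm u i : `|u 0 i| <= enorm u.
Proof.
rewrite -(ler_pXn2r (_ : (0 < 2)%N)) ?nnegrE // sqr_enorm real_normK ?num_real //.
rewrite /dotv (bigD1 i) //= -expr2 lerDl.
by apply: sumr_ge0 => j _; rewrite -expr2 sqr_ge0.
Qed.

Lemma enorm_eq0 u : enorm u <= 0 -> u = 0.
Proof.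
move=> u0; apply/rowP => i; rewrite mxE; apply/eqP.
by rewrite -normr_le0 (le_trans (normr_coord_le_enorm u i)).
Qed.

Lemma enorm0 : enorm (0 : 'rV[R]_k) = 0.
Proof. by rewrite /enorm dotv0r sqrtr0. Qed.

Lemma enormZ a u : enorm (a *: u) = `|a| * enorm u.
Proof.
by rewrite /enorm dotvZl dotvZr mulrA -expr2 sqrtrM ?sqr_ge0 // sqrtr_sqr.
Qed.

Lemma enormN u : enorm (- u) = enorm u.
Proof. by rewrite -scaleN1r enormZ normrN1 mul1r. Qed.

Lemma enorm_distC u v : enorm (u - v) = enorm (v - u).
Proof. by rewrite -enormN opprB. Qed.

(** The squared norm of [dotv v v *: u - dotv u v *: v] is [dotv v v] times the gap between the
    squared sides; hence the separate case [v = 0]. *)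
Lemma cauchy_schwarz u v : `|dotv u v| <= enorm u * enorm v.
Proof.
rewrite -(ler_pXn2r (_ : (0 < 2)%N)) ?nnegrE ?mulr_ge0 //.
rewrite exprMn !sqr_enorm real_normK ?num_real //.
have := dotvv_ge0 v; rewrite le_eqVlt => /predU1P[v0|v0].
  have -> : v = 0 by apply: enorm_eq0; rewrite /enorm -v0 sqrtr0.
  by rewrite !dotv0r mulr0 expr0n.
have := dotvv_ge0 (dotv v v *: u - dotv u v *: v).
rewrite !dotvE (dotvC v u) => h.
rewrite -(ler_pM2l v0) -subr_ge0; apply: le_trans h _.
by rewrite le_eqVlt; apply/orP; left; apply/eqP; ring.
Qed.

Lemma dotv_le u v : dotv u v <= enorm u * enorm v.
Proof. exact: le_trans (ler_norm _) (cauchy_schwarz u v). Qed.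

Lemma ler_enormD u v : enorm (u + v) <= enorm u + enorm v.
Proof.
rewrite -(ler_pXn2r (_ : (0 < 2)%N)) ?nnegrE ?addr_ge0 //.
have := dotv_le u v.
rewrite sqr_enorm !dotvE (dotvC v u) sqrrD !sqr_enorm -mulr_natr; lra.
Qed.

Lemma ler_enormB u v : enorm (u - v) <= enorm u + enorm v.
Proof. by rewrite -(enormN v) ler_enormD. Qed.

Lemma ler_enorm_dist w u v : enorm (u - v) <= enorm (u - w) + enorm (w - v).
Proof. by rewrite -[u - v](subrKA w) ler_enormD. Qed.

(** The topology of row vectors is that of the sup norm; this bound and the next carry
    neighbourhoods and boundedness over to [enorm]. *)
Lemma mx_norm_le_enorm u : `|u| <= enorm u.
Proof.
rewrite [leLHS]/Num.norm /=.
have [->//|/mx_norm_neq0[[i j] /= ->]] := eqVneq (mx_norm u) 0.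
by rewrite ord1 normr_coord_le_enorm.
Qed.

Lemma enorm_le_mx_norm u : enorm u <= k%:R * `|u|.
Proof.
rewrite -(ler_pXn2r (_ : (0 < 2)%N)) ?nnegrE ?mulr_ge0 // sqr_enorm.
have le_u i : u 0 i * u 0 i <= `|u| ^+ 2.
  rewrite -expr2 -[u 0 i ^+ 2]real_normK ?num_real //.
  rewrite ler_pXn2r ?nnegrE //.
  rewrite [leRHS]mx_normrE.
  exact: (le_bigmax_cond 0 (fun ij : 'I_1 * 'I_k => `|u ij.1 ij.2|) (j := (0, i))).
apply: (@le_trans _ _ (\sum_(i < k) `|u| ^+ 2)); first exact: ler_sum.
rewrite sumr_const card_ord exprMn -[leLHS]mulr_natl ler_wpM2r ?sqr_ge0 //.
by rewrite -natrX ler_nat; case: (k) => // q; rewrite leq_pmulr.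
Qed.

End Euclidean.

(** * Limits and compactness in the Euclidean norm *)

Section Topology.
Context {R : realType}.

Lemma harmonic_lt (e : R) : 0 < e ->
  exists N : nat, forall j, (N <= j)%N -> j.+1%:R^-1 < e.
Proof.
by move=> e0; have [N _ hN] := near_infty_natSinv_lt (PosNum e0); exists N.
Qed.

Lemma harmonic_gt0 (j : nat) : 0 < (j.+1%:R : R)^-1.
Proof. by rewrite invr_gt0. Qed.

Lemma harmonic_le1 (j : nat) : (j.+1%:R : R)^-1 <= 1.
Proof. by rewrite invf_le1 // ler1n. Qed.

Lemma cvg_real_near (x : nat -> R) (l e : R) : x @ \oo --> l -> 0 < e ->
  exists N : nat, forall j, (N <= j)%N -> `|x j - l| < e.
Proof. by move=> /cvgrPdistC_lt xl /xl[N _ hN]; exists N. Qed.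

Lemma cvg_real_harmonic (x : nat -> R) (l : R) :
  (forall j, `|x j - l| <= j.+1%:R^-1) -> x @ \oo --> l.
Proof.
move=> xl; apply/cvgrPdistC_lt => e /harmonic_lt[N hN].
by exists N => // j /= Nj; apply: le_lt_trans (xl j) (hN j Nj).
Qed.

Context {k : nat}.
Implicit Types (x y l : 'rV[R]_k) (S : set 'rV[R]_k).

Lemma nbhs_enorm x e : 0 < e -> nbhs x [set y | enorm (y - x) < e].
Proof.
(* [k.+1] in place of [k] keeps the radius positive in dimension zero. *)
move=> e0; apply/(@nbhs_normP _ 'rV[R]_k x); exists (e / k.+1%:R); first by rewrite /= divr_gt0.
move=> y /=; rewrite distrC ltr_pdivlMr // => xy.
apply: (le_lt_trans (enorm_le_mx_norm _)); apply: le_lt_trans xy.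
by rewrite mulrC ler_wpM2l // ler_nat.
Qed.

Lemma nbhs_enormE x (B : set 'rV[R]_k) : nbhs x B ->
  exists2 e, 0 < e & forall y, enorm (y - x) < e -> B y.
Proof.
move=> /(@nbhs_normP _ 'rV[R]_k x)[e /= e0 eB].
exists e => // y xy; apply: eB => /=.
by rewrite distrC (le_lt_trans (mx_norm_le_enorm _)).
Qed.

Lemma cvg_enorm_near (u : nat -> 'rV[R]_k) l e : u @ \oo --> l -> 0 < e ->
  exists N : nat, forall j, (N <= j)%N -> enorm (u j - l) < e.
Proof. by move=> ul /(nbhs_enorm l)/ul[N _ hN]; exists N. Qed.

Lemma cvg_enorm_harmonic (u : nat -> 'rV[R]_k) l :
  (forall j, enorm (u j - l) <= j.+1%:R^-1) -> u @ \oo --> l.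
Proof.
move=> ul B /nbhs_enormE[e /harmonic_lt[N hN] eB].
by exists N => // j /= /hN; move=> je; apply: eB; apply: le_lt_trans (ul j) je.
Qed.

Lemma closed_enorm S x : closed S ->
  (forall e, 0 < e -> exists2 y, S y & enorm (y - x) < e) -> S x.
Proof.
move=> clS Sx; apply: clS => B /nbhs_enormE[e /Sx[y Sy yx] eB].
by exists y; split => //; apply: eB.
Qed.

Lemma closed_of_enorm S :
  (forall x, (forall e, 0 < e -> exists2 y, S y & enorm (y - x) < e) -> S x) ->
  closed S.
Proof.
move=> h x clSx; apply: h => e /(nbhs_enorm x)/clSx[y [Sy xy]].
by exists y.
Qed.

Lemma compact_enorm_ball S (M : R) : closed S ->
  compact (S `&` [set y | enorm y <= M]).
Proof.
move=> clS; apply: bounded_closed_compact.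
  exists M; split; first exact: num_real.
  move=> M' MM' y [_ /= yM]; apply: le_trans (mx_norm_le_enorm y) _.
  by apply: le_trans yM (ltW _).
apply: closedI => //; apply: closed_of_enorm => y hy /=.
apply/ler_addgt0Pr => e /hy[z /= zM zy].
have := ler_enormB z (z - y); rewrite subKr => h.
lra.
Qed.

End Topology.

(** Subsequences are avoided: a cluster point is described by arbitrarily late indices at arbitrary
    precision. Compactness of a product of two balls makes these indices common to both
    sequences. *)
Lemma cluster_pair {R : realType} {n m : nat} (x : nat -> 'rV[R]_n)
    (y : nat -> 'rV[R]_m) (M : R) :
  (forall j, enorm (x j) <= M) -> (forall j, enorm (y j) <= M) ->
  exists a b, forall e N, 0 < e -> exists j,
    [/\ (N <= j)%N, enorm (x j - a) < e & enorm (y j - b) < e].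
Proof.
move=> xM yM.
have cx := compact_enorm_ball (M := M) (@closedT 'rV[R]_n).
have cy := compact_enorm_ball (M := M) (@closedT 'rV[R]_m).
pose z := fun j => (x j, y j).
have [|[a b] [_ ab]] := compact_setX cx cy (fmap_proper_filter z eventually_filter).
  by exists 0%N => // j _; split; split => /=.
exists a, b => e N e0.
have NF : (z @ \oo) [set p | exists2 j, (N <= j)%N & p = z j].
  by exists N => // j /= Nj; exists j.
have nab : nbhs (a, b) [set p | enorm (p.1 - a) < e /\ enorm (p.2 - b) < e].
  exists ([set p | enorm (p - a) < e], [set p | enorm (p - b) < e]) => //=.
  by split; exact: nbhs_enorm.
have [p [[j Nj ->] [/= ja jb]]] := ab _ _ NF nab.
by exists j.
Qed.

Lemma cluster_seq {R : realType} {n : nat} (x : nat -> 'rV[R]_n) (M : R) :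
  (forall j, enorm (x j) <= M) ->
  exists a, forall e N, 0 < e -> exists2 j, (N <= j)%N & enorm (x j - a) < e.
Proof.
move=> xM; have [a [b ab]] := cluster_pair xM xM.
by exists a => e N /(ab e N)[j [Nj ja _]]; exists j.
Qed.

Lemma continuous_dotv {R : realType} {k : nat} {T : topologicalType} (a : T)
    (f g : T -> 'rV[R]_k) :
  {for a, continuous f} -> {for a, continuous g} ->
  {for a, continuous (fun z => dotv (f z) (g z))}.
Proof.
move=> fa ga; apply: cvg_big => [|i _]; first exact: add_continuous.
apply: cvgM.
  exact: (@continuous_comp _ _ _ f (fun M : 'rV[R]_k => M 0 i) a fa
            (@coord_continuous _ _ _ _ _ _)).
exact: (@continuous_comp _ _ _ g (fun M : 'rV[R]_k => M 0 i) a ga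
          (@coord_continuous _ _ _ _ _ _)).
Qed.

(** * Boundedness and continuity of linear maps on row vectors *)

Section LinearBound.
Context {R : realType} {n : nat}.

Lemma linear_bound {V : normedModType R} (L : {linear 'rV[R]_n -> V}) :
  exists2 B : R, 0 <= B & forall w, `|L w| <= B * enorm w.
Proof.
exists (\sum_(i < n) `|L (delta_mx 0 i)|) => [|w]; first exact: sumr_ge0.
rewrite {1}(row_sum_delta w) linear_sum mulr_suml.
apply: le_trans (ler_norm_sum _ _ _) _; apply: ler_sum => i _.
by rewrite linearZ normrZ mulrC ler_wpM2l // normr_coord_le_enorm.
Qed.

Lemma linear_bound_rV {m : nat} (L : {linear 'rV[R]_n -> 'rV[R]_m}) :
  exists2 B : R, 0 <= B & forall w, enorm (L w) <= B * enorm w.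
Proof.
have [B B0 LB] := linear_bound L; exists (m%:R * B) => [|w]; first exact: mulr_ge0.
by apply: le_trans (enorm_le_mx_norm _) _; rewrite -mulrA ler_wpM2l.
Qed.

Lemma linear_rV_continuous {V : normedModType R} (L : {linear 'rV[R]_n -> V}) :
  continuous L.
Proof.
have [B B0 LB] := linear_bound L.
apply: bounded_linear_continuous; apply/linear_boundedP.
near=> r => x; apply: le_trans (LB x) _.
apply: (@le_trans _ _ (B * (n%:R * `|x|))).
  by rewrite ler_wpM2l // enorm_le_mx_norm.
by rewrite mulrA ler_wpM2r //; near: r; exact: nbhs_pinfty_ge.
Unshelve. all: by end_near.
Qed.

End LinearBound.

(** * Quadratic penalization *)

(** Expanding minimality gives [2 * dotv (a - u) (u' - u) <= enorm (u' - u) ^+ 2]: the vector is a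
    proximal normal, and its quadratic error is below any linear one near [u]. *)
Lemma reg_normal_proj {R : realType} {m : nat} (S : set 'rV[R]_m)
    (a u : 'rV[R]_m) (s : R) : 0 <= s -> S u ->
  (forall u', S u' -> dotv (a - u) (a - u) <= dotv (a - u') (a - u')) ->
  reg_normal S u (s *: (a - u)).
Proof.
move=> s0 Su umin; split=> // e e0; exists (e / (s + 1)) => [|u' Su'].
  by rewrite divr_gt0 // ltr_wpDl.
rewrite ltr_pdivlMr ?ltr_wpDl // => zlt.
have := umin _ Su'.
have -> : a - u' = (a - u) - (u' - u) by rewrite opprB addrA subrK.
rewrite dotvZl; move: (a - u) (u' - u) zlt => b z zlt.
have z0 := enorm_ge0 z; have zz := sqr_enorm z.
rewrite !dotvE (dotvC z b) -zz => h.
have h1 : s * dotv b z <= s * enorm z * enorm z by nra.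
have h2 : s * enorm z * enorm z <= e * enorm z by apply: ler_wpM2r => //; lra.
exact: le_trans h1 h2.
Qed.

Section Penalty.
Context {R : realType} {n m : nat}.
Variables (p : 'rV[R]_n) (G : {linear 'rV[R]_n -> 'rV[R]_m}) (h : 'rV[R]_m).

Definition penalty (eps j : R) (w : 'rV[R]_n) (u : 'rV[R]_m) : R :=
  dotv p w + 2^-1 * eps * dotv w w + 2^-1 * j * dotv (G w + h - u) (G w + h - u).

Lemma penalty_continuous eps j :
  continuous (fun z : 'rV[R]_n * 'rV[R]_m => penalty eps j z.1 z.2).
Proof.
move=> z.
have c1 : {for z, continuous (fun z : 'rV[R]_n * 'rV[R]_m => z.1)} by exact: cvg_fst.
have cG : {for z, continuous (fun z : 'rV[R]_n * 'rV[R]_m => G z.1 + h - z.2)}.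
  apply: continuousB; last exact: cvg_snd.
  apply: continuousD; last exact: cst_continuous.
  by apply: (@continuous_comp _ _ _ fst G z) => //; exact: linear_rV_continuous.
rewrite /continuous_at /penalty; apply: cvgD; [apply: cvgD|].
- by apply: continuous_dotv => //; exact: cst_continuous.
- by apply: cvgM; [exact: cvg_cst|exact: (continuous_dotv c1 c1)].
- by apply: cvgM; [exact: cvg_cst|exact: (continuous_dotv cG cG)].
Qed.

(** The quadratic terms make the penalty coercive: the sublevel set of its value at [(0, u0)] lies
    in a compact box, and a minimiser over that box is global. *)
Lemma penalty_minimizer (S : set 'rV[R]_m) eps j : closed S -> S !=set0 ->
  0 < eps -> 0 < j ->
  exists w u, S u /\ forall w' u', S u' -> penalty eps j w u <= penalty eps j w' u'.
Proof.
move=> clS [u0 Su0] e0 j0.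
have [B B0 GB] := linear_bound_rV G.
pose b := penalty eps j 0 u0.
have b0 : 0 <= b.
  rewrite /b /penalty linear0 add0r !dotv0r mulr0 !add0r.
  by rewrite !mulr_ge0 ?dotvv_ge0 ?invr_ge0 // ltW.
(* [W] comes from [eps * |w|^2 <= 2 * |p| * |w| + 2 * b] divided by [|w| > 1], the summand [1]
   covering the other case. [U] bounds [u = G w + h - a], where [|a| <= 1 + |a|^2] turns the bound
   on the penalty term into one on [a]. *)
pose W := 1 + (2 * enorm p + 2 * b) / eps.
pose U := B * W + enorm h + (1 + 2 / j * (b + enorm p * W)).
have p0 := enorm_ge0 p.
have W0 : 0 <= W.
  by rewrite addr_ge0 // divr_ge0 ?(ltW e0) //; lra.
have bnd w u : S u -> penalty eps j w u <= b -> enorm w <= W /\ enorm u <= U.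
  move=> Su; rewrite /penalty -!sqr_enorm; set a := G w + h - u => le_b.
  have w0 := enorm_ge0 w; have a0 := enorm_ge0 a.
  have pw : - (enorm p * enorm w) <= dotv p w.
    by have := cauchy_schwarz p w; rewrite ler_norml => /andP[].
  have ww : eps * enorm w ^+ 2 <= 2 * enorm p * enorm w + 2 * b.
    have : 0 <= j * enorm a ^+ 2 by rewrite mulr_ge0 ?sqr_ge0 ?ltW.
    by lra.
  have wW : enorm w <= W.
    rewrite /W; have [w1|w1] := leP (enorm w) 1.
      apply: le_trans w1 _; rewrite lerDl divr_ge0 ?(ltW e0) //; lra.
    apply: (@le_trans _ _ ((2 * enorm p + 2 * b) / eps)); last by lra.
    rewrite ler_pdivlMr // -(ler_pM2r (lt_trans ltr01 w1)).
    apply: (@le_trans _ _ (2 * enorm p * enorm w + 2 * b)); first by lra.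
    by nra.
  split=> //.
  have aa : enorm a <= 1 + 2 / j * (b + enorm p * W).
    have h1 : j * enorm a ^+ 2 <= 2 * (b + enorm p * W).
      have : 0 <= eps * enorm w ^+ 2 by rewrite mulr_ge0 ?sqr_ge0 ?ltW.
      have : enorm p * enorm w <= enorm p * W by rewrite ler_wpM2l.
      by lra.
    apply: (@le_trans _ _ (1 + enorm a ^+ 2)); first by nra.
    rewrite lerD2l mulrAC ler_pdivlMr // mulrC //.
  have -> : u = G w + h - a by rewrite /a subKr.
  apply: le_trans (ler_enormB _ _) _; rewrite lerD //.
  apply: le_trans (ler_enormD _ _) _; rewrite lerD2r.
  by apply: le_trans (GB w) _; rewrite ler_wpM2l.
have cA := compact_setX (compact_enorm_ball (M := W) (@closedT 'rV[R]_n))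
                        (compact_enorm_ball (M := U) clS).
set A := (X in compact X) in cA.
have A0 : A (0, u0).
  have [h1 h2] := bnd 0 u0 Su0 (lexx _).
  by split; split.
have [||[w u] Awu wumin] := compact_EVT_min (f := fun z => penalty eps j z.1 z.2) _ cA.
- by exists (0, u0).
- exact/continuous_subspaceT/penalty_continuous.
exists w, u; move: Awu => /set_mem[_ [Su _]]; split=> // w' u' Su'.
have [le_b|lt_b] := leP (penalty eps j w' u') b.
  have [h1 h2] := bnd _ _ Su' le_b.
  by apply: (wumin (w', u')); apply/mem_set; split; split.
apply: le_trans (ltW lt_b).
by apply: (wumin (0, u0)); apply/mem_set.
Qed.

(** Along the line [w + s *: z] the penalty varies by a polynomial [s * A + s ^+ 2 * B], and its
    nonnegativity for all [s] forces [A = 0]. *)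
Lemma penalty_stationary (eps j : R) (w : 'rV[R]_n) (u : 'rV[R]_m) :
  (forall w', penalty eps j w u <= penalty eps j w' u) ->
  forall z, dotv p z + eps * dotv w z + dotv (j *: (G w + h - u)) (G z) = 0.
Proof.
move=> wmin z; rewrite dotvZl.
set A := (X in X = 0).
pose B := 2^-1 * eps * dotv z z + 2^-1 * j * dotv (G z) (G z).
have AB s : 0 <= s * A + s ^+ 2 * B.
  have := wmin (w + s *: z); rewrite /penalty linearD linearZ /=.
  have -> : G w + s *: G z + h - u = (G w + h - u) + s *: G z.
    by rewrite [G w + s *: G z + h]addrAC [RHS]addrAC.
  rewrite /A /B; move: (G w + h - u) => a.
  by rewrite !dotvE (dotvC z w) (dotvC (G z) a); nra.
have [B0|B0] := leP B 0.
  have := AB 1; have := AB (-1); have := AB 2; have := AB (-2).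
  rewrite !sqrrN; nra.
(* The vertex of the parabola, where its value is [- A ^+ 2 / (4 * B)]. *)
pose s := - A / (2 * B).
have sB : s * (2 * B) = - A by rewrite divfK // gt_eqF // mulr_gt0.
have := AB s; nra.
Qed.

End Penalty.

(** This passes to the limit in an inequality without naming a convergent sequence: an error linear
    in [e], for small [e] only, is enough. *)
Lemma ler_of_small {R : realType} (C x y : R) : 0 <= C ->
  (forall e, 0 < e -> e <= 1 -> x <= y + C * e) -> x <= y.
Proof.
move=> C0 xy; apply/ler_addgt0Pr => e e0.
have C1 : 0 < C + 1 by rewrite ltr_wpDl.
have f0 : 0 < Num.min 1 (e / (C + 1)) by rewrite lt_min ltr01 divr_gt0.
have := xy _ f0; rewrite ge_min lexx => /(_ isT) h; apply: le_trans h _.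
rewrite lerD2l; apply: (@le_trans _ _ ((C + 1) * (e / (C + 1)))); last first.
  by rewrite mulrC divfK // gt_eqF.
apply: ler_pM => //; [exact: ltW|by rewrite lerDl|by rewrite ge_min lexx orbT].
Qed.

Lemma eq0_of_small {R : realType} (C x : R) : 0 <= C ->
  (forall e, 0 < e -> e <= 1 -> `|x| <= C * e) -> x = 0.
Proof.
move=> C0 xC; apply/eqP; rewrite -normr_le0.
by apply: (ler_of_small C0) => e e0 e1; rewrite add0r xC.
Qed.

Lemma lim_normal_near {R : realType} {m : nat} (S : set 'rV[R]_m) (u lam : 'rV[R]_m) :
  (forall e, 0 < e -> exists y v,
     [/\ reg_normal S y v, enorm (y - u) < e & enorm (v - lam) < e]) ->
  lim_normal S u lam.
Proof.
move=> H; have /choice[yv hyv] : forall j : nat, exists yv : 'rV[R]_m * 'rV[R]_m,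
    [/\ reg_normal S yv.1 yv.2, enorm (yv.1 - u) < j.+1%:R^-1
      & enorm (yv.2 - lam) < j.+1%:R^-1].
  by move=> j; have [y [v]] := H _ (harmonic_gt0 j); exists (y, v).
exists (fun j => (yv j).1), (fun j => (yv j).2); split; [|split].
- by apply: cvg_enorm_harmonic => j; have [_ /ltW] := hyv j.
- by apply: cvg_enorm_harmonic => j; have [_ _ /ltW] := hyv j.
- by move=> j; have [] := hyv j.
Qed.

(** * Multipliers of a linear system under a global error bound *)

Section Multiplier.
Context {R : realType} {n m : nat}.
Variables (p : 'rV[R]_n) (G : {linear 'rV[R]_n -> 'rV[R]_m}) (h : 'rV[R]_m).
Variables (gam kap : R) (S : set 'rV[R]_m) (F : set 'rV[R]_n).
Hypothesis clS : closed S.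
Hypothesis kap0 : 0 < kap.
Hypothesis FS : forall w, F w -> S (G w + h).
Hypothesis error_bound : forall w u, S u ->
  exists2 w', F w' & enorm (w' - w) <= kap * enorm (G w + h - u).

(** At [u = G w + h] the error bound has right-hand side zero, so its feasible point is [w] itself.
    Together with [FS], this makes [F] the full preimage of [S]. *)
Lemma feasible_of_image w : S (G w + h) -> F w.
Proof.
move=> /(error_bound w)[w' Fw']; rewrite subrr enorm0 mulr0 => /enorm_eq0/eqP.
by rewrite subr_eq0 => /eqP <-.
Qed.

(** These constants depend on a feasible [w0] but neither on [eps] nor on [j]: [M0] bounds the
    regularized objective at [w0] for [eps <= 1], [X0] will bound [eps * |w|], and [L0] the
    multipliers. *)
Let M0 (w0 : 'rV[R]_n) : R := enorm p * enorm w0 + 2^-1 * enorm w0 ^+ 2.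
Let X0 w0 : R := 2 * enorm p + 1 + 2 * M0 w0.
Let L0 w0 : R := 4 * (enorm p + X0 w0) * kap.

(** Comparing with [w0] bounds [eps * |w|]. Comparing with the feasible [w'] that the error bound
    gives for [(w, u)] bounds the multiplier: with [a = G w + h - u], the penalty term
    [j / 2 * |a|^2] is at most the change of the objective from [w] to [w'], which is of order [|a|]
    up to a quadratic term. *)
Lemma penalty_multiplier_bound (w0 : 'rV[R]_n) (eps j : R) (w : 'rV[R]_n)
    (u : 'rV[R]_m) : F w0 -> 0 < eps -> eps <= 1 -> 2 * kap ^+ 2 + 1 <= j -> S u ->
  (forall w' u', S u' -> penalty p G h eps j w u <= penalty p G h eps j w' u') ->
  eps * enorm w <= X0 w0 /\ j * enorm (G w + h - u) <= L0 w0.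
Proof.
move=> Fw0 e0 e1 jk Su wumin.
have kk := sqr_ge0 kap.
have j0 : 0 < j by apply: lt_le_trans jk; rewrite ltr_wpDl // mulr_ge0.
have p0 := enorm_ge0 p; have w00 := enorm_ge0 w0; have wn0 := enorm_ge0 w.
have a0 := enorm_ge0 (G w + h - u).
have pw : - (enorm p * enorm w) <= dotv p w.
  by have := cauchy_schwarz p w; rewrite ler_norml => /andP[].
have M00 : 0 <= M0 w0 by rewrite addr_ge0 ?mulr_ge0 ?invr_ge0 ?sqr_ge0.
have qw0 : dotv p w0 + 2^-1 * eps * enorm w0 ^+ 2 <= M0 w0.
  by have := dotv_le p w0; have := sqr_ge0 (enorm w0); rewrite /M0; nra.
have X : eps * enorm w <= X0 w0.
  have := wumin w0 _ (FS Fw0); rewrite /penalty subrr dotv0r mulr0 addr0.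
  rewrite -!sqr_enorm => hq.
  have ja : 0 <= j * enorm (G w + h - u) ^+ 2 by rewrite mulr_ge0 ?sqr_ge0 ?ltW.
  have q : 2^-1 * (eps * enorm w ^+ 2) <= M0 w0 + enorm p * enorm w by lra.
  set x := eps * enorm w.
  have x0 : 0 <= x by rewrite mulr_ge0 // ltW.
  have xx : x ^+ 2 <= 2 * M0 w0 + 2 * enorm p * x.
    have -> : x ^+ 2 = 2 * eps * (2^-1 * (eps * enorm w ^+ 2)).
      by rewrite /x; field.
    apply: (@le_trans _ _ (2 * eps * (M0 w0 + enorm p * enorm w))).
      by rewrite ler_wpM2l // mulr_ge0 // ltW.
    by rewrite /x; nra.
  rewrite /X0 leNgt; apply/negP => xlt; nra.
split=> //.
have [w' Fw' ww'] := error_bound w Su.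
have := wumin w' _ (FS Fw'); rewrite /penalty subrr dotv0r mulr0 addr0.
move: (G w + h - u) ww' a0 => a ww' a0.
have -> : w' = w + (w' - w) by rewrite addrC subrK.
move: (w' - w) ww' => z zle; rewrite !dotvE (dotvC z w) -!sqr_enorm => hq.
have z0 := enorm_ge0 z.
have pz := dotv_le p z.
have wz : eps * dotv w z <= X0 w0 * enorm z.
  apply: (@le_trans _ _ (eps * (enorm w * enorm z))).
    by rewrite ler_wpM2l ?dotv_le // ltW.
  by rewrite mulrA ler_wpM2r.
have ez : eps * enorm z ^+ 2 <= enorm z ^+ 2 by rewrite ler_piMl ?sqr_ge0.
have zz : enorm z ^+ 2 <= kap ^+ 2 * enorm a ^+ 2.
  by rewrite -exprMn lerXn2r // ?nnegrE // mulr_ge0 // ltW.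
have X00 : 0 <= enorm p + X0 w0 by rewrite /X0 !addr_ge0 ?mulr_ge0.
have pXz : (enorm p + X0 w0) * enorm z <= (enorm p + X0 w0) * (kap * enorm a).
  by rewrite ler_wpM2l.
have main : j * enorm a ^+ 2 <= 2 * (enorm p + X0 w0) * (kap * enorm a) +
    kap ^+ 2 * enorm a ^+ 2 by lra.
have [a1|a1] := leP (enorm a) 0.
  have -> : enorm a = 0 by apply/eqP; rewrite eq_le a1.
  by rewrite mulr0 /L0 mulr_ge0 ?mulr_ge0 // ltW.
rewrite -(ler_pM2r a1) /L0.
(* The threshold on [j] lets half of the left side absorb the quadratic term. *)
have : kap ^+ 2 * enorm a ^+ 2 <= 2^-1 * (j * enorm a ^+ 2).
  by have := sqr_ge0 (enorm a); nra.
by rewrite expr2 in main *; lra.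
Qed.

(** Here [j] tends to infinity with [eps] fixed. Both [w k] and [lam k] stay bounded, and [u k]
    differs from [G (w k) + h] by [lam k] divided by [jj k], so a common cluster point satisfies
    everything. The bound on [lam] is uniform in [eps], which the next limit requires. *)
Lemma regularized_multiplier (w0 : 'rV[R]_n) (eps : R) :
  F w0 -> 0 < eps -> eps <= 1 ->
  exists w lam, [/\ F w, lim_normal S (G w + h) lam,
    (forall z, dotv p z + eps * dotv w z + dotv lam (G z) = 0),
    dotv p w + 2^-1 * eps * dotv w w <= dotv p w0 + 2^-1 * eps * dotv w0 w0 &
    enorm lam <= L0 w0].
Proof.
move=> Fw0 e0 e1.
have [B B0 GB] := linear_bound_rV G.
pose jj (k : nat) : R := 2 * kap ^+ 2 + k.+1%:R.
have kk := sqr_ge0 kap.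
have jk1 k : 2 * kap ^+ 2 + 1 <= jj k by rewrite lerD2l ler1n.
have jk2 k : k.+1%:R <= jj k by rewrite lerDr mulr_ge0.
have j0 k : 0 < jj k by apply: lt_le_trans (jk2 k).
have /choice[wu hwu] : forall k, exists wu : 'rV[R]_n * 'rV[R]_m, S wu.2 /\
    forall w' u', S u' ->
      penalty p G h eps (jj k) wu.1 wu.2 <= penalty p G h eps (jj k) w' u'.
  move=> k; have S0 : S !=set0 by exists (G w0 + h); exact: FS.
  have [w [u hwu]] := penalty_minimizer p G h clS S0 e0 (j0 k).
  by exists (w, u).
pose w k := (wu k).1; pose u k := (wu k).2.
pose lam k := jj k *: (G (w k) + h - u k).
have Su k : S (u k) by have [] := hwu k.
have wumin k := (hwu k).2.
have bnds k := penalty_multiplier_bound Fw0 e0 e1 (jk1 k) (Su k) (wumin k).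
have lamL k : enorm (lam k) <= L0 w0.
  by rewrite enormZ gtr0_norm //; have [] := bnds k.
have reg k : reg_normal S (u k) (lam k).
  apply: reg_normal_proj; [exact: ltW|exact: Su|move=> u' Su'].
  have := wumin k (w k) u' Su'; rewrite /penalty lerD2l.
  by rewrite ler_pM2l // mulr_gt0 // invr_gt0.
have stat k := penalty_stationary (fun w' => wumin k w' _ (Su k)).
have val k : dotv p (w k) + 2^-1 * eps * dotv (w k) (w k) <=
    dotv p w0 + 2^-1 * eps * dotv w0 w0.
  have := wumin k w0 _ (FS Fw0); rewrite /penalty subrr dotv0r mulr0 addr0.
  apply: le_trans; rewrite lerDl mulr_ge0 ?dotvv_ge0 // mulr_ge0 ?invr_ge0 //.
  exact: ltW.
have L00 : 0 <= L0 w0 by apply: le_trans (enorm_ge0 _) (lamL 0%N).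
have X00 : 0 <= X0 w0.
  apply: le_trans (bnds 0%N).1; rewrite mulr_ge0 ?enorm_ge0 //; exact: ltW.
pose M := X0 w0 / eps + L0 w0.
have wX k : enorm (w k) <= X0 w0 / eps.
  by rewrite ler_pdivlMr // mulrC; exact: (bnds k).1.
have wM k : enorm (w k) <= M by apply: le_trans (wX k) _; rewrite lerDl.
have lM k : enorm (lam k) <= M.
  by apply: le_trans (lamL k) _; rewrite lerDr divr_ge0 // ltW.
have M0' : 0 <= M by apply: le_trans (enorm_ge0 _) (lM 0%N).
clearbody M.
have [wb [lb clus]] := cluster_pair wM lM.
have uE k : u k = G (w k) + h - (jj k)^-1 *: lam k.
  by rewrite /lam scalerA mulVf ?gt_eqF // scale1r subKr.
have near e : 0 < e -> exists k, [/\ enorm (u k - (G wb + h)) < e,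
    enorm (lam k - lb) < e & enorm (w k - wb) < e].
  move=> e_gt0.
  have f0 : 0 < e / (2 * (L0 w0 + 1)) by rewrite divr_gt0 // mulr_gt0 // ltr_wpDl.
  have [N hN] := harmonic_lt f0.
  have g0 : 0 < Num.min e (e / (2 * (B + 1))).
    by rewrite lt_min e_gt0 divr_gt0 // mulr_gt0 // ltr_wpDl.
  have [k [Nk]] := clus _ N g0; rewrite !lt_min => /andP[we we'] /andP[le _].
  exists k; split=> //.
  have -> : u k - (G wb + h) = G (w k - wb) - (jj k)^-1 *: lam k.
    by apply/rowP => i; rewrite uE linearB /= !mxE; ring.
  have b1 : enorm (G (w k - wb)) <= 2^-1 * e.
    apply: le_trans (GB _) _; move: (enorm_ge0 (w k - wb)) we'.
    rewrite ltr_pdivlMr ?mulr_gt0 ?ltr_wpDl // => x0 xlt.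
    by nra.
  have b2 : enorm ((jj k)^-1 *: lam k) < 2^-1 * e.
    rewrite enormZ gtr0_norm ?invr_gt0 //.
    have := hN k Nk; rewrite ltr_pdivlMr ?mulr_gt0 ?ltr_wpDl // => hk.
    have jinv : (jj k)^-1 <= k.+1%:R^-1 by rewrite lef_pV2 // posrE.
    have : (jj k)^-1 * enorm (lam k) <= k.+1%:R^-1 * L0 w0.
      by apply: ler_pM; rewrite ?enorm_ge0 ?invr_ge0 ?(ltW (j0 k)).
    move: (harmonic_gt0 (R := R) k) hk; move: (L0 w0) (_^-1) => L x; nra.
  apply: le_lt_trans (ler_enormB _ _) _; lra.
exists wb, lb; split.
(* The [u k] accumulate at [G wb + h], which closedness puts in [S]; the error bound then makes [wb]
   feasible. *)
- apply: feasible_of_image; apply: (closed_enorm clS) => e /near[k [ue _ _]].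
  by exists (u k).
- by apply: lim_normal_near => e /near[k [ue le _]]; exists (u k), (lam k).
- move=> z; apply: (@eq0_of_small _ (eps * enorm z + enorm (G z))).
    by rewrite addr_ge0 ?mulr_ge0 ?enorm_ge0 // ltW.
  move=> e e_gt0 _; have [k [_ le we]] := near e e_gt0.
  have -> : dotv p z + eps * dotv wb z + dotv lb (G z) =
      - (eps * dotv (w k - wb) z + dotv (lam k - lb) (G z)).
    by have := stat k z; rewrite !dotvBl -/(lam k) -/(w k); lra.
  rewrite normrN; apply: le_trans (ler_normD _ _) _; rewrite normrM gtr0_norm //.
  have h1 := cauchy_schwarz (w k - wb) z.
  have h2 := cauchy_schwarz (lam k - lb) (G z).
  have h3 : enorm (w k - wb) * enorm z <= e * enorm z.
    by rewrite ler_wpM2r ?enorm_ge0 // ltW.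
  have h4 : enorm (lam k - lb) * enorm (G z) <= e * enorm (G z).
    by rewrite ler_wpM2r ?enorm_ge0 // ltW.
  have h5 : eps * `|dotv (w k - wb) z| <= eps * (e * enorm z).
    by rewrite ler_wpM2l ?(ltW e0) //; lra.
  by lra.
- apply: (@ler_of_small _ (enorm p + (enorm wb + M))).
    by rewrite addr_ge0 ?addr_ge0 ?enorm_ge0.
  move=> e e_gt0 _; have [k [_ _ we]] := near e e_gt0.
  have vk := val k.
  have h1 : dotv p wb - dotv p (w k) <= enorm p * e.
    rewrite -dotvBr; apply: le_trans (dotv_le _ _) _.
    by rewrite ler_wpM2l ?enorm_ge0 // enorm_distC ltW.
  have h2 : dotv wb wb - dotv (w k) (w k) <= (enorm wb + M) * e.
    have -> : dotv wb wb - dotv (w k) (w k) = dotv (wb + w k) (wb - w k).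
      by rewrite !dotvE (dotvC wb (w k)); ring.
    apply: le_trans (dotv_le _ _) _; apply: ler_pM; rewrite ?enorm_ge0 //.
      by apply: le_trans (ler_enormD _ _) _; rewrite lerD2l.
    by rewrite enorm_distC ltW.
  have h3 : eps * (dotv wb wb - dotv (w k) (w k)) <= (enorm wb + M) * e.
    have : 0 <= (enorm wb + M) * e := mulr_ge0 (addr_ge0 (enorm_ge0 _) M0') (ltW e_gt0).
    by nra.
  have h4 : 0 <= (enorm wb + M) * e := mulr_ge0 (addr_ge0 (enorm_ge0 _) M0') (ltW e_gt0).
  by lra.
- apply: (@ler_of_small _ 1) => // e /near[k [_ le _]] _.
  have := ler_enormB (lam k) (lam k - lb); rewrite subKr.
  by have := lamL k; lra.
Qed.

Hypothesis pos : forall w, F w -> 0 <= dotv p w + gam.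

(** Here [eps] tends to zero. The minimisers [w] may be unbounded, so only the multipliers are given
    a cluster point [lam], and normality is kept at nearby [lam']. The term [eps *: w] vanishes in
    the limit because [eps * |w|^2] is bounded. *)
Lemma exists_multiplier : S !=set0 ->
  exists lam, (forall z, dotv p z + dotv lam (G z) = 0) /\
  forall e, 0 < e -> exists w lam', [/\ F w, lim_normal S (G w + h) lam',
    enorm (lam' - lam) < e & dotv lam' (G w + h) <= gam + dotv lam' h].
Proof.
move=> [u0 Su0]; have [w0 Fw0 _] := error_bound 0 Su0.
have /choice[wl hwl] : forall k : nat, exists wl : 'rV[R]_n * 'rV[R]_m,
   let eps := k.+1%:R^-1 in [/\ F wl.1, lim_normal S (G wl.1 + h) wl.2,
    (forall z, dotv p z + eps * dotv wl.1 z + dotv wl.2 (G z) = 0),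
    dotv p wl.1 + 2^-1 * eps * dotv wl.1 wl.1 <= dotv p w0 + 2^-1 * eps * dotv w0 w0 &
    enorm wl.2 <= L0 w0].
  move=> k.
  have [w [lam hwl]] := regularized_multiplier Fw0 (harmonic_gt0 k) (harmonic_le1 k).
  by exists (w, lam).
have [lam clus] : exists lam, forall e N, 0 < e ->
    exists2 j, (N <= j)%N & enorm ((wl j).2 - lam) < e.
  by apply: (cluster_seq (M := L0 w0)) => j; have [] := hwl j.
exists lam; split=> [z|e e0]; last first.
  have [k _ ke] := clus e 0%N e0; have [Fw Nw st _ _] := hwl k.
  exists (wl k).1, (wl k).2; split => //.
  (* Stationarity tested at [z = w] gives [dotv lam' (G w) = - dotv p w - eps * |w|^2], and [pos]
     bounds this by [gam]. *)
  rewrite dotvDr lerD2r; have := st (wl k).1; have := pos Fw.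
  move: (harmonic_gt0 (R := R) k) {st}; move: (k.+1%:R^-1) => eps eps0.
  by have := mulr_ge0 (ltW eps0) (dotvv_ge0 (wl k).1); lra.
apply: (@eq0_of_small _ (enorm z + enorm (G z))).
  by rewrite addr_ge0 ?enorm_ge0.
move=> e e0 _.
have [M [M2 M1]] : exists M, 0 <= M /\ M0 w0 + gam <= M.
  by exists `|M0 w0 + gam|; rewrite ler_norm.
(* The lower bound [pos] and the comparison with [w0] give [eps * |w|^2 <= 2 * M], so
   [eps * |w| <= e] as soon as [eps * (2 * M + 1) < e ^+ 2]. *)
have f0 : 0 < e ^+ 2 / (2 * M + 1).
  by rewrite divr_gt0 ?exprn_gt0 // ltr_wpDl // mulr_ge0.
have [N hN] := harmonic_lt f0.
have [k Nk ke] := clus e N e0; have [Fw _ st val _] := hwl k.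
have := hN k Nk; have eps0 := harmonic_gt0 (R := R) k; have eps1 := harmonic_le1 (R := R) k.
move: (k.+1%:R^-1) st val eps0 eps1 => eps st val eps0 eps1.
move: (wl k).1 (wl k).2 ke Fw st val => w l le Fw st val.
rewrite ltr_pdivlMr ?ltr_wpDl ?mulr_ge0 // => epsM.
have ew : eps * enorm w <= e.
  rewrite -(ler_pXn2r (_ : (0 < 2)%N)) ?nnegrE ?mulr_ge0 ?enorm_ge0 ?(ltW eps0) ?(ltW e0) //.
  have pw0 := dotv_le p w0.
  rewrite -!sqr_enorm in val.
  have w02 := sqr_ge0 (enorm w0).
  have e2 : 2^-1 * eps * enorm w0 ^+ 2 <= 2^-1 * enorm w0 ^+ 2.
    by rewrite -mulrA ler_wpM2l ?invr_ge0 // ler_piMl.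
  have q : eps * enorm w ^+ 2 <= 2 * M.
    by have := pos Fw; rewrite /M0 in M1; lra.
  have -> : (eps * enorm w) ^+ 2 = eps * (eps * enorm w ^+ 2) by ring.
  apply: (@le_trans _ _ (eps * (2 * M))); first by rewrite ler_wpM2l // ltW.
  by lra.
have -> : dotv p z + dotv lam (G z) = - (eps * dotv w z + dotv (l - lam) (G z)).
  by have := st z; rewrite dotvBl; lra.
rewrite normrN; apply: le_trans (ler_normD _ _) _; rewrite normrM gtr0_norm //.
have h1 := cauchy_schwarz w z.
have h2 := cauchy_schwarz (l - lam) (G z).
have h3 : eps * `|dotv w z| <= e * enorm z.
  apply: (@le_trans _ _ (eps * (enorm w * enorm z))).
    by rewrite ler_wpM2l // ltW.
  by rewrite mulrA ler_wpM2r ?enorm_ge0.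
have h4 : enorm (l - lam) * enorm (G z) <= e * enorm (G z).
  by rewrite ler_wpM2r ?enorm_ge0 // ltW.
by lra.
Qed.

End Multiplier.

(** * Second-order tangent sets and their normals *)

Section Projection.
Context {R : realType} {m : nat}.
Implicit Types (S : set 'rV[R]_m) (a b u l : 'rV[R]_m).

Lemma exists_projection S a : closed S -> S !=set0 ->
  exists2 u, S u & forall u', S u' -> enorm (a - u) <= enorm (a - u').
Proof.
move=> clS S0.
(* With [w] in dimension zero, [h = a] and both weights [1], the penalty is half the squared
   distance from [a] to [u], up to terms free of [u]. *)
have [w [u [Su umin]]] :=
  penalty_minimizer (0 : 'rV[R]_0) (mulmxr (0 : 'M[R]_(0, m))) a clS S0 ltr01 ltr01.
exists u => // u' /(umin 0); rewrite (thinmx0 w) /penalty lerD2l linear0 add0r.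
by rewrite ler_pM2l ?mulr1 ?invr_gt0 // /enorm => h; rewrite ler_sqrt ?dotvv_ge0.
Qed.

Lemma closed_affine_preimage S b (rho : R) : 0 < rho -> closed S ->
  closed [set w | S (b + rho *: w)].
Proof.
move=> rho0 clS; apply: closed_of_enorm => w hw /=; apply: (closed_enorm clS) => e e0.
have [|w' /= Sw' ww'] := hw (e / rho); first by rewrite divr_gt0.
exists (b + rho *: w') => //; rewrite opprD addrACA subrr add0r -scalerBr.
by rewrite enormZ gtr0_norm // mulrC -ltr_pdivlMr.
Qed.

(** The dilation multiplies both sides of the defining inequality by [rho], so the normal vector is
    unchanged and only the radius is rescaled. *)
Lemma reg_normal_affine_preimage S b (rho : R) u l : 0 < rho ->
  reg_normal [set w | S (b + rho *: w)] u l -> reg_normal S (b + rho *: u) l.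
Proof.
move=> rho0 [Su nu]; split=> // e e0; have [del del0 ndel] := nu _ e0.
exists (rho * del); rewrite ?mulr_gt0 // => y Sy yu.
pose u' := rho^-1 *: (y - b).
have yE : y = b + rho *: u'.
  by rewrite /u' scalerA divff ?gt_eqF // scale1r addrC subrK.
have yuE : y - (b + rho *: u) = rho *: (u' - u).
  by rewrite yE opprD addrACA subrr add0r -scalerBr.
move: yu; rewrite yuE enormZ gtr0_norm // ltr_pM2l // => uu.
rewrite dotvZr mulrCA ler_pM2l //; apply: ndel => //=.
by rewrite -yE.
Qed.

End Projection.

Section SecondOrderTangents.
Context {R : realType}.
Variable Q : R -> R -> R -> Prop.
Hypothesis Q_mono : forall e e' t r, e <= e' -> Q e t r -> Q e' t r.

(* With [Q e t r := t = r] this is [tangent2], and with [Q e t r := t / r < e]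
   it is [tangent2asym]. *)
Definition tangentQ {k : nat} (S : set 'rV[R]_k) (y v : 'rV[R]_k) : set 'rV[R]_k :=
  [set w | forall e, 0 < e -> exists t r w', [/\ 0 < t < e, 0 < r < e, Q e t r,
     enorm (w' - w) < e & S (y + t *: v + (2^-1 * t * r) *: w')]].

Context {k : nat}.
Implicit Types (S K : set 'rV[R]_k) (y v w : 'rV[R]_k).

Lemma tangentQ_near S y v w :
  (forall e, 0 < e -> exists t r w', [/\ 0 < t <= e, 0 < r <= e, Q e t r,
     enorm (w' - w) <= e & S (y + t *: v + (2^-1 * t * r) *: w')]) ->
  tangentQ S y v w.
Proof.
move=> h e e0; have e2 : 0 < e / 2 by rewrite divr_gt0.
have lt_e : e / 2 < e by rewrite ltr_pdivrMr // ltr_pMr // ltr1n.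
have [t [r [w' [/andP[t0 te] /andP[r0 re] q ww' Sw']]]] := h _ e2.
exists t, r, w'; split=> //.
- by rewrite t0 (le_lt_trans te).
- by rewrite r0 (le_lt_trans re).
- by apply: Q_mono q; exact: ltW.
- exact: le_lt_trans lt_e.
Qed.

Lemma tangentQ_closed S y v : closed (tangentQ S y v).
Proof.
apply: closed_of_enorm => w hw; apply: tangentQ_near => e e0.
have e2 : 0 < e / 2 by rewrite divr_gt0.
have le_e : e / 2 <= e by rewrite ler_pdivrMr // ler_pMr // ler1n.
have [w1 Tw1 ww1] := hw _ e2.
have [t [r [w' [/andP[t0 te] /andP[r0 re] q ww' Sw']]]] := Tw1 _ e2.
exists t, r, w'; split=> //.
- by rewrite t0 (le_trans (ltW te)).
- by rewrite r0 (le_trans (ltW re)).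
- exact: Q_mono q.
- by apply: le_trans (ler_enorm_dist w1 _ _) _; lra.
Qed.

(* A normal [lam] to an outer limit at [u] is recovered, up to a small error,
   from the projections of [u + s lam] onto the sets of the sequence. *)
Lemma reg_normal_tangentQ K y v u lam : closed K ->
  reg_normal (tangentQ K y v) u lam ->
  forall e, 0 < e -> exists t v' l, [/\ 0 < t < e, enorm (v' - v) < e,
    enorm (l - lam) < e & reg_normal K (y + t *: v') l].
Proof.
move=> clK [Tu nu] e e0.
have eta0 : 0 < e / 4 by rewrite divr_gt0.
have [del del0 ndel] := nu _ eta0; set eta := e / 4 in eta0 ndel.
have l0 := enorm_ge0 lam.
(* The step is short enough for limits of the projections of [u + s *: lam] to stay within [del] of
   [u], where the normal inequality applies. *)
pose s := del / (2 * enorm lam + 1).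
have d0 : 0 < 2 * enorm lam + 1 by rewrite ltr_wpDl // mulr_ge0.
have s0 : 0 < s by rewrite divr_gt0.
have sdel : 2 * (s * enorm lam) < del.
  have : s * (2 * enorm lam + 1) = del by rewrite divfK // gt_eqF.
  by move: s s0 => x; lra.
clearbody s.
have /choice[tru htru] : forall j : nat, exists tru : R * R * 'rV[R]_k,
    let: (t, r, u') := tru in [/\ 0 < t < j.+1%:R^-1, 0 < r < j.+1%:R^-1,
     Q j.+1%:R^-1 t r, enorm (u' - u) < j.+1%:R^-1 &
     K (y + t *: v + (2^-1 * t * r) *: u')].
  by move=> j; have [t [r [u' h]]] := Tu _ (harmonic_gt0 j); exists (t, r, u').
pose t j := (tru j).1.1; pose r j := (tru j).1.2; pose u' j := (tru j).2.
have {}htru j : [/\ 0 < t j < j.+1%:R^-1, 0 < r j < j.+1%:R^-1,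
     Q j.+1%:R^-1 (t j) (r j), enorm (u' j - u) < j.+1%:R^-1 &
     K (y + t j *: v + (2^-1 * t j * r j) *: u' j)].
  by have := htru j; rewrite /t /r /u'; case: (tru j) => [[]].
have t0 j : 0 < t j by have [/andP[]] := htru j.
have r0 j : 0 < r j by have [_ /andP[]] := htru j.
have rho0 j : 0 < 2^-1 * t j * r j by rewrite !mulr_gt0 ?invr_gt0.
pose a := u + s *: lam.
have au : enorm (a - u) = s * enorm lam.
  by rewrite /a addrAC subrr add0r enormZ gtr0_norm.
have /choice[q hq] : forall j, exists q, K (y + t j *: v + (2^-1 * t j * r j) *: q) /\
    forall q', K (y + t j *: v + (2^-1 * t j * r j) *: q') -> enorm (a - q) <= enorm (a - q').
  move=> j; have clj := closed_affine_preimage (b := y + t j *: v) (rho0 j) clK.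
  have [|q Kq qmin] := exists_projection a clj; last by exists q.
  by exists (u' j); have [] := htru j.
have qa j : enorm (a - q j) <= s * enorm lam + j.+1%:R^-1.
  have [_ _ _ /ltW uu Ku] := htru j.
  apply: le_trans ((hq j).2 _ Ku) _; apply: le_trans (ler_enorm_dist u _ _) _.
  by rewrite au lerD2l enorm_distC.
pose M := enorm a + (s * enorm lam + 1).
have M0 : 0 <= M by rewrite addr_ge0 ?enorm_ge0 // addr_ge0 // mulr_ge0 // ltW.
have qM j : enorm (q j) <= M.
  have := ler_enormB a (a - q j); rewrite subKr => /le_trans; apply.
  by rewrite lerD2l (le_trans (qa j)) // lerD2l harmonic_le1.
have [z clus] := cluster_seq qM.
have Tz : tangentQ K y v z.
  move=> f f0; have [N hN] := harmonic_lt f0.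
  have [j Nj jz] := clus f N f0; have jf := hN j Nj.
  have [/andP[_ tj] /andP[_ rj] Qj _ _] := htru j.
  exists (t j), (r j), (q j); split=> //.
  - by rewrite t0 (lt_trans tj).
  - by rewrite r0 (lt_trans rj).
  - by apply: Q_mono Qj; exact: ltW.
  - exact: (hq j).1.
have za : enorm (z - a) <= s * enorm lam.
  apply: (@ler_of_small _ 2) => // f f0 _; have [N hN] := harmonic_lt f0.
  have [j Nj jz] := clus f N f0; have jf := hN j Nj.
  have := ler_enorm_dist (q j) z a; have := qa j.
  rewrite (enorm_distC z (q j)) (enorm_distC (q j) a).
  by move: (j.+1%:R^-1) jf => x; lra.
have zdel : enorm (z - u) < del.
  by apply: le_lt_trans (ler_enorm_dist a _ _) _; rewrite au; lra.
(* Expanding [|z - u - s *: lam|^2 <= (s * |lam|)^2] leaves [|z - u|^2 <= 2 * s * dotv lam (z - u)],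
   and normality bounds the right side by [2 * s * eta * |z - u|]. *)
have zu : enorm (z - u) <= 2 * (s * eta).
  have h1 := ndel _ Tz zdel.
  have : enorm (z - a) ^+ 2 <= (s * enorm lam) ^+ 2.
    by rewrite lerXn2r ?nnegrE ?enorm_ge0 // mulr_ge0 // ltW.
  have -> : z - a = (z - u) - s *: lam by rewrite /a opprD addrA.
  move: (z - u) h1 => x; have x0 := enorm_ge0 x.
  rewrite exprMn !sqr_enorm !dotvE (dotvC x lam) -sqr_enorm => h1 h2.
  have h3 : enorm x ^+ 2 <= 2 * (s * eta) * enorm x by nra.
  have [x1|x1] := leP (enorm x) 0.
    by apply: le_trans x1 _; rewrite !mulr_ge0 // ltW.
  by rewrite -(ler_pM2r x1) -expr2.
have f0 : 0 < s * eta by rewrite mulr_gt0.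
have g0 : 0 < e / (M + 1) by rewrite divr_gt0 // ltr_wpDl.
have [N hN] := harmonic_lt g0.
have [j Nj jz] := clus _ N f0.
have := hN j Nj; have [/andP[_ tj] /andP[_ rj] _ _ _] := htru j.
move: (j.+1%:R^-1) tj rj => x tj rj; rewrite ltr_pdivlMr ?ltr_wpDl // => xM.
(* The second-order point is read as a first-order one by moving [r / 2 * q] into the direction. The
   rescaled residual differs from [lam] by [(u - q) / s], of norm below [3 * eta < e]. *)
exists (t j), (v + (2^-1 * r j) *: q j), (s^-1 *: (a - q j)); split.
- by rewrite t0 /=; have := t0 j; nra.
- rewrite addrAC subrr add0r enormZ gtr0_norm ?mulr_gt0 ?invr_gt0 //.
  have h1 : r j * enorm (q j) <= r j * M by rewrite ler_wpM2l // ltW.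
  by have := r0 j; nra.
- have -> : s^-1 *: (a - q j) - lam = s^-1 *: (u - q j).
    by apply/rowP => i; rewrite /a !mxE; field; rewrite gt_eqF.
  rewrite enormZ gtr0_norm ?invr_gt0 // mulrC ltr_pdivrMr //.
  have := ler_enorm_dist z u (q j); rewrite (enorm_distC u z) (enorm_distC z (q j)).
  by rewrite /eta in f0 zu jz *; lra.
- have -> : y + t j *: (v + (2^-1 * r j) *: q j) =
      y + t j *: v + (2^-1 * t j * r j) *: q j.
    by rewrite scalerDr addrA scalerA mulrCA mulrA.
  apply: reg_normal_affine_preimage => //.
  apply: reg_normal_proj; [by rewrite invr_ge0 ltW|exact: (hq j).1|].
  move=> q' /(hq j).2; rewrite -!sqr_enorm => h.
  by rewrite lerXn2r ?nnegrE ?enorm_ge0.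
Qed.

Lemma dir_normal_near K y v lam :
  (forall e, 0 < e -> exists t v' l, [/\ 0 < t < e, enorm (v' - v) < e,
    enorm (l - lam) < e & reg_normal K (y + t *: v') l]) ->
  dir_normal K y v lam.
Proof.
move=> H; have /choice[f hf] : forall j : nat, exists f : R * 'rV[R]_k * 'rV[R]_k,
    [/\ 0 < f.1.1 < j.+1%:R^-1, enorm (f.1.2 - v) < j.+1%:R^-1,
      enorm (f.2 - lam) < j.+1%:R^-1 & reg_normal K (y + f.1.1 *: f.1.2) f.2].
  by move=> j; have [t [v' [l h]]] := H _ (harmonic_gt0 j); exists (t, v', l).
exists (fun j => (f j).1.1), (fun j => (f j).1.2), (fun j => (f j).2).
split; [|split; [|split; [|split]]].
- by move=> j; have [/andP[]] := hf j.
- apply: cvg_real_harmonic => j; have [/andP[t0 tj] _ _ _] := hf j.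
  by rewrite subr0 gtr0_norm // ltW.
- by apply: cvg_enorm_harmonic => j; have [_ /ltW] := hf j.
- by apply: cvg_enorm_harmonic => j; have [_ _ /ltW] := hf j.
- by move=> j; have [] := hf j.
Qed.

(** Three approximations, each within [e / 3]: [lam] by limiting normals, these by regular normals
    of the tangent set, and these by regular normals of [K]. The base points [u] may vary freely,
    since only the direction [v] enters the conclusion. *)
Lemma dir_normal_of_lim_normal K y v lam : closed K ->
  (forall e, 0 < e -> exists u lam',
     lim_normal (tangentQ K y v) u lam' /\ enorm (lam' - lam) < e) ->
  dir_normal K y v lam.
Proof.
move=> clK H; apply: dir_normal_near => e e0.
have e3 : 0 < e / 3 by rewrite divr_gt0.
have [u [lam' [[yk [vk [_ [vkl reg]]]] ll]]] := H _ e3.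
have [N hN] := cvg_enorm_near vkl e3.
have [t [v' [l [/andP[t0 te] vv le nl]]]] := reg_normal_tangentQ clK (reg N) e3.
exists t, v', l; split=> //; [by rewrite t0 /=; lra|by lra|].
have := hN N (leqnn N); have := ler_enorm_dist (vk N) l lam.
by have := ler_enorm_dist lam' (vk N) lam; lra.
Qed.

End SecondOrderTangents.

(** * Second-order expansion *)

Lemma enorm_le_coord {R : realType} {k : nat} (u : 'rV[R]_k) (b : R) : 0 <= b ->
  (forall i, `|u 0 i| <= b) -> enorm u <= k%:R * b.
Proof.
move=> b0 ub; apply: le_trans (enorm_le_mx_norm u) _; rewrite ler_wpM2l //.
rewrite [leLHS]/Num.norm /=.
have [->//|/mx_norm_neq0[[i j] /= ->]] := eqVneq (mx_norm u) 0.
by rewrite ord1.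
Qed.

(** This makes estimates proved coordinate by coordinate simultaneous. Starting the minimum at [1]
    keeps it positive when [k = 0]. *)
Lemma common_radius {R : realType} {k : nat} (P : 'I_k -> R -> Prop) :
  (forall i a b, a <= b -> P i b -> P i a) ->
  (forall i, exists2 a, 0 < a & P i a) -> exists2 a, 0 < a & forall i, P i a.
Proof.
move=> Pmono h; have /choice[a ha] : forall i, exists a, 0 < a /\ P i a.
  by move=> i; have [a a0 Pa] := h i; exists a.
exists (\big[Num.min/1]_i a i) => [|i].
  by apply: lt_bigmin => // i _; exact: (ha i).1.
by apply: (Pmono i _ (a i)); [exact: bigmin_le_cond|exact: (ha i).2].
Qed.

Section Expansion.
Context {R : realType} {n : nat}.
Variable F : 'rV[R]_n -> R.
Hypothesis dF : forall x, differentiable F x.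

Lemma is_derive_line (x v : 'rV[R]_n) (s : R) :
  is_derive s (1 : R) (fun s : R => F (x + s *: v)) ('D_v F (x + s *: v)).
Proof.
have E : (fun h : R => h^-1 *: (((fun s : R => F (x + s *: v)) \o shift s) (h *: (1 : R))
            - F (x + s *: v))) =
    (fun h : R => h^-1 *: ((F \o shift (x + s *: v)) (h *: v) - F (x + s *: v))).
  apply/funext => h /=; congr (_ *: (F _ - _)).
  by rewrite [h *: 1]mulr1 scalerDl addrCA.
split; last by rewrite /derive E.
by rewrite /derivable E; exact: diff_derivable.
Qed.

Lemma MVT_line (x v : 'rV[R]_n) :
  exists2 c : R, 0 < c < 1 & F (x + v) - F x = 'D_v F (x + c *: v).
Proof.
have [||c c01] := @MVT R (fun s => F (x + s *: v)) (fun s => 'D_v F (x + s *: v)) 0 1 ltr01.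
- by move=> s _; exact: is_derive_line.
- apply: derivable_within_continuous => s _.
  exact: (@ex_derive _ _ _ _ _ _ _ (is_derive_line x v s)).
by rewrite scale1r scale0r addr0 subr0 mulr1 => E; exists c.
Qed.

Definition grad (x : 'rV[R]_n) : 'rV[R]_n := \row_i 'D_(delta_mx 0 i) F x.

Lemma derive_grad (x w : 'rV[R]_n) : 'D_w F x = dotv (grad x) w.
Proof.
rewrite deriveE // {1}(row_sum_delta w) linear_sum; apply: eq_bigr => i _.
by rewrite linearZ mxE deriveE //= mulrC.
Qed.

Hypothesis d2F : forall v x, differentiable ('D_v F) x.

Lemma grad_continuous (x : 'rV[R]_n) (e : R) : 0 < e ->
  exists2 del, 0 < del & forall y, enorm (y - x) < del -> enorm (grad y - grad x) <= e.
Proof.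
move=> e0; have n0 : 0 < n.+1%:R :> R by [].
have e'0 : 0 < e / n.+1%:R by rewrite divr_gt0.
have [|i|del del0 hdel] := @common_radius R n (fun i del => forall y, enorm (y - x) < del ->
   `|'D_(delta_mx 0 i) F y - 'D_(delta_mx 0 i) F x| < e / n.+1%:R).
- by move=> i a b ab h y ya; apply: h; exact: lt_le_trans ab.
- have c := differentiable_continuous (d2F (delta_mx 0 i) x).
  have /cvgrPdistC_lt/(_ _ e'0) : 'D_(delta_mx 0 i) F y @[y --> x] --> 'D_(delta_mx 0 i) F x by [].
  by move=> /nbhs_enormE.
exists del => // y /hdel h; apply: (@le_trans _ _ (n%:R * (e / n.+1%:R))).
  by apply: enorm_le_coord => [|i]; [exact: ltW|rewrite !mxE ltW].
by rewrite mulrCA ler_piMr ?(ltW e0) // ler_pdivrMr // mul1r ler_nat.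
Qed.

(** The derivative stays at [x] while the base point moves: this is strict differentiability, from
    the mean value theorem and the continuity of the gradient. It will be used at
    [y = x + t *: d]. *)
Lemma expansion1 (x : 'rV[R]_n) (e : R) : 0 < e ->
  exists2 del, 0 < del & forall y z, enorm (y - x) < del -> enorm z < del ->
    `|F (y + z) - F y - 'D_z F x| <= e * enorm z.
Proof.
move=> e0; have [del del0 hdel] := grad_continuous x e0.
exists (del / 2) => [|y z yx zd]; first by rewrite divr_gt0.
have [c /andP[c0 c1] ->] := MVT_line y z.
rewrite !derive_grad -dotvBl; apply: le_trans (cauchy_schwarz _ _) _.
rewrite ler_wpM2r ?enorm_ge0 //; apply: hdel.
rewrite addrAC; apply: le_lt_trans (ler_enormD _ _) _.
rewrite enormZ gtr0_norm //; have := enorm_ge0 z; nra.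
Qed.

(** The mean value theorem is applied to the Taylor remainder [phi], whose derivative is the
    first-order remainder of ['D_d F] along [d], of size at most [e * s]. *)
Lemma expansion2 (x d : 'rV[R]_n) (e : R) : 0 < e ->
  exists2 del, 0 < del & forall t, 0 < t -> t < del ->
    `|F (x + t *: d) - F x - t * 'D_d F x - 2^-1 * t ^+ 2 * 'D_d ('D_d F) x|
      <= e * t ^+ 2.
Proof.
move=> e0; set D2 := 'D_d ('D_d F) x.
have : derivable ('D_d F) x d by exact: diff_derivable.
move=> /cvg_ex[l' hl]; have {hl} : (fun h : R => h^-1 *: (('D_d F \o shift x) (h *: d) - 'D_d F x))
    @ (0 : R)^' --> D2 by rewrite /D2 /derive; apply/cvg_ex; exists l'.
move=> /cvgrPdistC_lt/(_ _ e0)/nbhs_ballP[del /= del0 hdel].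
exists del => // t t0 td.
have step s : 0 < s -> s < del -> `|'D_d F (x + s *: d) - 'D_d F x - s * D2| <= e * s.
  move=> s0 sd; have := hdel s; rewrite /ball /= sub0r normrN gtr0_norm // => /(_ sd).
  rewrite gt_eqF // => /(_ isT); rewrite [s *: d + x]addrC => /ltW h.
  have -> : 'D_d F (x + s *: d) - 'D_d F x - s * D2 =
      s * (s^-1 *: ('D_d F (x + s *: d) - 'D_d F x) - D2).
    rewrite [s^-1 *: _](_ : _ = s^-1 * ('D_d F (x + s *: d) - 'D_d F x)) //.
    by rewrite [RHS]mulrBr mulrA mulfV ?gt_eqF // mul1r.
  by rewrite normrM gtr0_norm // mulrC ler_pM2r.
pose phi (s : R) := F (x + s *: d) - (s * 'D_d F x + 2^-1 * s ^+ 2 * D2).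
pose dphi (s : R) := 'D_d F (x + s *: d) - ('D_d F x + s * D2).
have dphiE s : is_derive s (1 : R) phi (dphi s).
  have ? := is_derive_line x d s.
  apply: is_derive_eq; rewrite /dphi; congr (_ - _).
  by rewrite !scaler0 !add0r /GRing.scale /=; field.
have [|c c01] := MVT t0 (fun s _ => dphiE s).
  by apply: derivable_within_continuous => s _; exact: (@ex_derive _ _ _ _ _ _ _ (dphiE s)).
move: c01; rewrite in_itv /= => /andP[c0 ct].
rewrite subr0 /phi scale0r addr0 mul0r expr0n mulr0 mul0r addr0 subr0.
have := step c c0 (lt_trans ct td); rewrite -[_ - _ - c * D2]addrA -opprD -/(dphi c) => h E.
have -> : F (x + t *: d) - F x - t * 'D_d F x - 2^-1 * t ^+ 2 * D2 = dphi c * t.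
  by rewrite -E; ring.
rewrite normrM (gtr0_norm t0) expr2 mulrA ler_pM2r //.
by apply: le_trans h _; rewrite ler_pM2l // ltW.
Qed.

(** The ratio condition turns the term in [t ^+ 2] into [theta * t * r], so that one formula serves
    both scalings, uniformly over bounded [w]. *)
Lemma expansion (x d : 'rV[R]_n) (theta M eta : R) : 0 <= theta -> 0 <= M -> 0 < eta ->
  exists2 del, 0 < del & forall t r w, 0 < t -> t < del -> 0 < r -> r < del ->
    `|t - theta * r| <= del * r -> enorm w <= M ->
    `|F (x + t *: d + (2^-1 * t * r) *: w) - F x - t * 'D_d F x
       - 2^-1 * t * r * ('D_w F x + theta * 'D_d ('D_d F) x)| <= eta * (t * r).
Proof.
move=> th0 M0 eta0; set D2 := 'D_d ('D_d F) x.
have M1 : 0 < M + 1 by rewrite ltr_wpDl.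
have th1 : 0 < theta + 1 by rewrite ltr_wpDl.
have D1 : 0 < `|D2| + 1 by rewrite ltr_wpDl.
have d1 : 0 < enorm d + 1 by rewrite ltr_wpDl // enorm_ge0.
have [|del1 del1_0 h1] := @expansion1 x (eta / 3 / (M + 1)); first by rewrite !divr_gt0.
have [|del2 del2_0 h2] := @expansion2 x d (eta / 3 / (theta + 1)); first by rewrite !divr_gt0.
pose del := Num.min 1 (Num.min (del1 / (enorm d + 1)) (Num.min (del1 / (M + 1))
  (Num.min del2 (eta / 3 / (`|D2| + 1))))).
exists del => [|t r w t0 td r0 rd trd wM].
  by rewrite !lt_min ltr01 del2_0 !divr_gt0.
move: td; rewrite !lt_min => /andP[t1 /andP[tdd /andP[tdM /andP[tdel2 tD]]]].
move: rd; rewrite !lt_min => /andP[r1 _].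
have {}trd : `|t - theta * r| <= r /\ `|t - theta * r| <= eta / 3 / (`|D2| + 1) * r.
  by split; apply: le_trans trd _; rewrite ?ler_piMl ?ler_pM2r ?(ltW r0) // /del !ge_min lexx ?orbT.
case: trd => tr1 tr2.
set y := x + t *: d; set z := (2^-1 * t * r) *: w.
have tr0 : 0 < t * r by rewrite mulr_gt0.
have zE : enorm z = 2^-1 * (t * r) * enorm w.
  by rewrite /z enormZ gtr0_norm ?mulrA // !mulr_gt0 ?invr_gt0.
have w0 := enorm_ge0 w.
have yx : enorm (y - x) < del1.
  rewrite /y addrAC subrr add0r enormZ gtr0_norm //.
  move: tdd; rewrite ltr_pdivlMr // => h; have := enorm_ge0 d; nra.
have zd : enorm z < del1.
  rewrite zE; move: tdM; rewrite ltr_pdivlMr // => h.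
  have a1 : t * r <= t by rewrite ler_piMr // ltW.
  have a2 : t * r * enorm w <= t * M by apply: ler_pM => //; exact: ltW.
  by have := mulr_ge0 (ltW tr0) w0; lra.
have A := h1 _ _ yx zd; have B := h2 _ t0 tdel2.
have Dz : 'D_z F x = 2^-1 * t * r * 'D_w F x by rewrite !derive_grad dotvZr.
rewrite Dz -/D2 in A B.
(* The three summands are the increment from [y] to [y + z], the second-order remainder along [d],
   and the cost of replacing [t] by [theta * r]; each gets a third of [eta]. *)
have -> : F (y + z) - F x - t * 'D_d F x - 2^-1 * t * r * ('D_w F x + theta * D2) =
   (F (y + z) - F y - 2^-1 * t * r * 'D_w F x) +
   (F y - F x - t * 'D_d F x - 2^-1 * t ^+ 2 * D2) + 2^-1 * t * ((t - theta * r) * D2).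
  by ring.
apply: le_trans (ler_normD _ _) _; apply: le_trans (lerD (ler_normD _ _) (lexx _)) _.
have A' : eta / 3 / (M + 1) * enorm z <= eta / 3 * (t * r).
  rewrite zE -mulrA ler_pM2l ?divr_gt0 // ler_pdivrMl //; nra.
have B' : eta / 3 / (theta + 1) * t ^+ 2 <= eta / 3 * (t * r).
  rewrite -mulrA ler_pM2l ?divr_gt0 // ler_pdivrMl //.
  have : t <= (theta + 1) * r by move: tr1; rewrite ler_norml => /andP[_]; lra.
  by move=> h; rewrite expr2 mulrCA ler_pM2l.
have C' : `|2^-1 * t * ((t - theta * r) * D2)| <= eta / 3 * (t * r).
  rewrite !normrM (gtr0_norm t0) gtr0_norm ?invr_gt0 //.
  have c1 : `|t - theta * r| * `|D2| <= eta / 3 * r.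
    apply: (@le_trans _ _ (eta / 3 / (`|D2| + 1) * r * (`|D2| + 1))).
      by apply: ler_pM => //; rewrite lerDl.
    by rewrite mulrAC divfK // gt_eqF.
  have c2 : 0 <= `|t - theta * r| * `|D2| by rewrite mulr_ge0.
  nra.
by lra.
Qed.

End Expansion.

Section VectorCalculus.
Context {R : realType} {n m : nat}.

Lemma differentiable_comp_coord (g : 'rV[R]_n -> 'rV[R]_m) x i : differentiable g x ->
  differentiable (fun y => g y 0 i) x.
Proof.
move=> dg; apply: (@differentiable_comp _ _ _ _ g (fun M : 'rV[R]_m => M 0 i : R)) => //.
exact: differentiable_coord.
Qed.

Lemma derive_coord (g : 'rV[R]_n -> 'rV[R]_m) x v i : differentiable g x ->
  'D_v (fun y => g y 0 i) x = ('D_v g x) 0 i.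
Proof. by move=> dg; rewrite derive_mx ?mxE //; exact: diff_derivable. Qed.

Variable g : 'rV[R]_n -> 'rV[R]_m.
Hypothesis dg : forall x, differentiable g x.
Hypothesis d2g : forall v x, differentiable ('D_v g) x.

Lemma expansion_rV (x d : 'rV[R]_n) (theta M eta : R) :
  0 <= theta -> 0 <= M -> 0 < eta ->
  exists2 del, 0 < del & forall t r w, 0 < t -> t < del -> 0 < r -> r < del ->
    `|t - theta * r| <= del * r -> enorm w <= M ->
    enorm (g (x + t *: d + (2^-1 * t * r) *: w) - g x - t *: 'D_d g x
       - (2^-1 * t * r) *: ('D_w g x + theta *: 'D_d ('D_d g) x)) <= eta * (t * r).
Proof.
move=> th0 M0 eta0.
have e0 : 0 < eta / m.+1%:R by rewrite divr_gt0.
have [||del del0 hdel] := @common_radius R m (fun i del => forall t r w,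
   0 < t -> t < del -> 0 < r -> r < del ->
    `|t - theta * r| <= del * r -> enorm w <= M ->
    `|(g (x + t *: d + (2^-1 * t * r) *: w) - g x - t *: 'D_d g x
       - (2^-1 * t * r) *: ('D_w g x + theta *: 'D_d ('D_d g) x)) 0 i|
      <= eta / m.+1%:R * (t * r)).
- move=> i a b ab h t r w t0 ta r0 ra tr; apply: h => //.
  + exact: lt_le_trans ab.
  + exact: lt_le_trans ab.
  + by apply: le_trans tr _; rewrite ler_pM2r.
- move=> i.
  have dF y : differentiable (fun y => g y 0 i) y by exact: differentiable_comp_coord.
  have DE v : 'D_v (fun y => g y 0 i) = (fun y => ('D_v g y) 0 i).
    by apply/funext => y; exact: derive_coord.
  have d2F v y : differentiable ('D_v (fun y => g y 0 i)) y.
    by rewrite DE; exact: differentiable_comp_coord.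
  have [del del0 hdel] := expansion dF d2F x d th0 M0 e0.
  exists del => // t r w t0 td r0 rd tr wM.
  by have := hdel t r w t0 td r0 rd tr wM; rewrite !mxE !DE !derive_coord.
exists del => // t r w t0 td r0 rd tr wM.
have tr0 : 0 < t * r by rewrite mulr_gt0.
apply: le_trans (enorm_le_coord (b := eta / m.+1%:R * (t * r)) _ _) _.
- by rewrite mulr_ge0 // ltW.
- by move=> i; exact: hdel.
rewrite mulrA ler_pM2r // mulrCA ler_piMr ?(ltW eta0) //.
by rewrite ler_pdivrMr // mul1r ler_nat.
Qed.

End VectorCalculus.

(** The derivative is again a [lagr], so the formula can be iterated to reach the second
    derivative. *)
Lemma derive_lagr {R : realType} {n m : nat} (f : 'rV[R]_n -> R)
    (g : 'rV[R]_n -> 'rV[R]_m) lam v x : differentiable f x -> differentiable g x ->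
  'D_v (lagr f g lam) x = lagr ('D_v f) ('D_v g) lam x.
Proof.
move=> dfx dgx.
have dgi i : derivable (fun y => g y 0 i) x v.
  exact/diff_derivable/differentiable_comp_coord.
have E : lagr f g lam = f + \sum_(i < m) (lam 0 i \*: (fun y => g y 0 i)).
  by apply/funext => y; rewrite /lagr fctE fct_sumE; congr (_ + _).
rewrite E deriveD; last 2 first.
- exact: diff_derivable.
- by apply: derivable_sum => i; exact: derivableZ.
rewrite derive_sum; last by move=> i; exact: derivableZ.
by congr (_ + _); apply: eq_bigr => i _; rewrite deriveZ // derive_coord.
Qed.

(** The point is [t *: (d + z)] with [z = r / 2 * w] small, and the angular deviation of [d + z]
    from [d] is at most [2 * |z| * |d|]. *)
Lemma dir_nbhd_near {R : realType} {n : nat} (d : 'rV[R]_n) (rho del M : R) :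
  0 < rho -> 0 < del -> 0 <= M ->
  exists2 e, 0 < e & forall t r w, 0 < t -> t < e -> 0 < r -> r < e ->
    enorm w <= M -> dir_nbhd rho del d (t *: d + (2^-1 * t * r) *: w).
Proof.
move=> rho0 del0 M0; have d0 := enorm_ge0 d.
have M1 : 0 < M + 1 by rewrite ltr_wpDl.
have [e [e0 e1 edel erho]] : exists e, [/\ 0 < e, e <= 1, e * (enorm d + M + 1) <= del &
    0 < enorm d -> e * (M * (2 + rho)) <= rho * enorm d].
  have a0 : 0 < enorm d + M + 1 by lra.
  have b0 : 0 < M * (2 + rho) + 1 by rewrite ltr_wpDl // mulr_ge0 //; lra.
  have [d1|d1] := leP (enorm d) 0.
    exists (Num.min 1 (del / (enorm d + M + 1))); split.
    - by rewrite lt_min ltr01 divr_gt0.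
    - by rewrite ge_min lexx.
    - by rewrite -ler_pdivlMr // ge_min lexx orbT.
    - by lra.
  exists (Num.min 1 (Num.min (del / (enorm d + M + 1)) (rho * enorm d / (M * (2 + rho) + 1)))).
  split.
  - by rewrite !lt_min ltr01 !divr_gt0 ?mulr_gt0.
  - by rewrite ge_min lexx.
  - by rewrite -ler_pdivlMr // !ge_min lexx orbT.
  - move=> _; set e := Num.min _ _.
    have e0 : 0 <= e by rewrite /e !le_min ler01 !divr_ge0 ?mulr_ge0 // ltW.
    have : e * (M * (2 + rho) + 1) <= rho * enorm d.
      by rewrite -ler_pdivlMr // /e !ge_min lexx !orbT.
    by clearbody e; lra.
exists e => // t r w t0 te r0 re wM.
pose z := (2^-1 * r) *: w.
have zE : enorm z = 2^-1 * r * enorm w.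
  by rewrite enormZ gtr0_norm ?mulr_gt0 ?invr_gt0.
have w0 := enorm_ge0 w; have z0 := enorm_ge0 z.
have zM : 2 * enorm z <= e * M.
  have : r * enorm w <= e * M by apply: ler_pM; rewrite ?(ltW r0) ?(ltW re).
  by rewrite zE; lra.
have -> : t *: d + (2^-1 * t * r) *: w = t *: (d + z).
  by rewrite scalerDr /z scalerA; congr (_ + _ *: _); ring.
have dz : enorm (d + z) <= enorm d + enorm z by exact: ler_enormD.
have dz' : enorm d <= enorm (d + z) + enorm z.
  by have := ler_enormB (d + z) z; rewrite addrK.
clearbody z; move: (enorm_ge0 (d + z)) => dz0.
split; rewrite enormZ gtr0_norm //.
  have h1 : enorm (d + z) <= enorm d + M + 1 by nra.
  have : t * enorm (d + z) <= e * (enorm d + M + 1).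
    by apply: ler_pM => //; exact: ltW.
  by lra.
have -> : enorm d *: (t *: (d + z)) - (t * enorm (d + z)) *: d =
    t *: (enorm d *: z + (enorm d - enorm (d + z)) *: d).
  by apply/rowP => i; rewrite !mxE; ring.
rewrite enormZ gtr0_norm // [rho * _]mulrCA -mulrA ler_pM2l //.
apply: le_trans (ler_enormD _ _) _; rewrite !enormZ (ger0_norm d0).
have ndz : `|enorm d - enorm (d + z)| <= enorm z by rewrite ler_norml; apply/andP; lra.
have h1 : `|enorm d - enorm (d + z)| * enorm d <= enorm z * enorm d.
  by rewrite ler_wpM2r.
(* For [d = 0] both sides of the angular condition vanish; otherwise [|d + z|] is bounded below by
   [|d| - |z|]. *)
have [d1|d1] := leP (enorm d) 0.
  have -> : enorm d = 0 by lra.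
  by rewrite !mulr0 mul0r addr0.
have : 2 * enorm z <= rho * enorm (d + z).
  have := erho d1; nra.
by move=> h2; have := ler_wpM2r d0 h2; lra.
Qed.

(** * The constraint system *)

Lemma enorm_diff_bound {R : realType} {n m : nat} (g : 'rV[R]_n -> 'rV[R]_m) x :
  differentiable g x ->
  exists2 B : R, 0 <= B & forall w w', enorm ('D_w' g x - 'D_w g x) <= B * enorm (w' - w).
Proof.
move=> dgx; have [B B0 hB] := linear_bound_rV ('d g x).
by exists B => // w w'; rewrite !deriveE // -linearB.
Qed.

Lemma edist_le {R : realType} {k : nat} (S : set 'rV[R]_k) x y : S y ->
  Defs.edist x S <= enorm (x - y).
Proof.
by move=> Sy; apply: ge_inf; [exists 0 => _ [z _ <-]; exact: enorm_ge0|exists y].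
Qed.

(** The infimum is only approached. Nonemptiness matters because the real infimum of an empty set is
    a default value. *)
Lemma edist_near {R : realType} {k : nat} (S : set 'rV[R]_k) x (e : R) :
  S !=set0 -> 0 < e -> exists2 y, S y & enorm (x - y) < Defs.edist x S + e.
Proof.
move=> [y0 Sy0] e0; have [|_ [y Sy <-] h] := @inf_adherent R [set enorm (x - y) | y in S] e e0.
  split; first by exists (enorm (x - y0)), y0.
  by exists 0 => _ [z _ <-]; exact: enorm_ge0.
by exists y.
Qed.

Section Constraint.
Context {R : realType} {n m : nat}.
Variables (f : 'rV[R]_n -> R) (g : 'rV[R]_n -> 'rV[R]_m) (K : set 'rV[R]_m).
Variables (xb d : 'rV[R]_n).
Variables (Q : R -> R -> R -> Prop) (theta : R).
Hypothesis Q_mono : forall e e' t r, e <= e' -> Q e t r -> Q e' t r.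
Hypothesis theta0 : 0 <= theta.
Hypothesis Q_ratio : forall e t r, 0 < t < e -> 0 < r -> Q e t r -> `|t - theta * r| <= e * r.
Hypothesis f2 : C2R f.
Hypothesis g2 : C2 g.

Let C := g @^-1` K.
Let v := 'D_d g xb.
(** Over the tangent set of [C] this ranges over [Theta] when [theta = 0] and over [Omega] when
    [theta = 1]. *)
Let image w := 'D_w g xb + theta *: 'D_d ('D_d g) xb.

(** The vector [u] is the second-order difference quotient of [g], which makes the equation exact
    and moves the whole error into [u - image w]. *)
Lemma tangentQ_expansion (M eta : R) : 0 <= M -> 0 < eta ->
  exists2 del, 0 < del & forall e t r w, e <= del -> 0 < t < e -> 0 < r < e ->
    Q e t r -> enorm w <= M -> exists2 u, enorm (u - image w) <= eta &
    g (xb + t *: d + (2^-1 * t * r) *: w) = g xb + t *: v + (2^-1 * t * r) *: u.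
Proof.
move=> M0 eta0; have [dg [d2g _]] := g2.
have e20 : 0 < eta / 2 by rewrite divr_gt0.
have [del del0 hdel] := expansion_rV dg d2g xb d theta0 M0 e20.
exists del => // e t r w ed te' /andP[r0 re] Qt wM; have /andP[t0 te] := te'.
have tr0 : 0 < 2^-1 * t * r by rewrite !mulr_gt0 ?invr_gt0.
pose u := (2^-1 * t * r)^-1 *:
  (g (xb + t *: d + (2^-1 * t * r) *: w) - g xb - t *: v).
have uE : (2^-1 * t * r) *: u = g (xb + t *: d + (2^-1 * t * r) *: w) - g xb - t *: v.
  by rewrite /u scalerA mulfV ?gt_eqF // scale1r.
exists u; last by rewrite uE -[_ - g xb - _]addrA -opprD [RHS]addrC subrK.
have := hdel t r w t0 (lt_le_trans te ed) r0 (lt_le_trans re ed).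
have tre : `|t - theta * r| <= del * r.
  by apply: le_trans (Q_ratio te' r0 Qt) _; rewrite ler_pM2r.
move=> /(_ tre wM); rewrite -/v -uE -/(image w) -scalerBr enormZ gtr0_norm //.
have -> : eta / 2 * (t * r) = 2^-1 * t * r * eta by field.
by rewrite ler_pM2l.
Qed.

Lemma tangentQ_image w : tangentQ Q C xb d w -> tangentQ Q K (g xb) v (image w).
Proof.
move=> Tw; apply: tangentQ_near => // e e0; have [dg _] := g2.
have [B B0 hB] := enorm_diff_bound (dg xb).
have B1 : 0 < 2 * (B + 1) by rewrite mulr_gt0 // ltr_wpDl.
have M0 : 0 <= enorm w + 1 by rewrite addr_ge0 // enorm_ge0.
have [|del del0 hdel] := tangentQ_expansion M0 (eta := e / 2); first by rewrite divr_gt0.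
pose e' := Num.min del (Num.min (Num.min e 1) (e / (2 * (B + 1)))).
have e'0 : 0 < e' by rewrite !lt_min del0 e0 ltr01 divr_gt0.
have e'e : e' <= e by rewrite /e' !ge_min lexx !orbT.
have e'1 : e' <= 1 by rewrite /e' !ge_min lexx !orbT.
have e'B : e' <= e / (2 * (B + 1)) by rewrite /e' !ge_min lexx !orbT.
have e'd : e' <= del by rewrite /e' !ge_min lexx.
have [t [r [w' [te re q ww' Cw']]]] := Tw _ e'0; clearbody e'.
have w'M : enorm w' <= enorm w + 1.
  have := ler_enormD (w' - w) w; rewrite subrK => /le_trans; apply.
  by rewrite addrC lerD2l (le_trans (ltW ww')).
have [u uw E] := hdel e' t r w' e'd te re q w'M.
exists t, r, u; split.
- by have /andP[-> /ltW/le_trans->] := te.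
- by have /andP[-> /ltW/le_trans->] := re.
- exact: Q_mono q.
- apply: le_trans (ler_enorm_dist (image w') _ _) _.
  have -> : image w' - image w = 'D_w' g xb - 'D_w g xb.
    by rewrite /image opprD addrACA subrr addr0.
  have h1 := hB w w'.
  have h2 : B * enorm (w' - w) <= e / 2.
    move: e'B; rewrite ler_pdivlMr // => h3; have := enorm_ge0 (w' - w); nra.
  by lra.
- by rewrite -E.
Qed.

(** Along the points realising [w], [f] is at least [f xb]; the first-order term vanishes, and
    dividing the expansion by [t * r / 2] leaves the claimed sign up to a small error. *)
Lemma tangentQ_opt w : loc_opt_dir f g K xb d -> 'D_d f xb = 0 ->
  tangentQ Q C xb d w -> 0 <= 'D_w f xb + theta * 'D_d ('D_d f) xb.
Proof.
move=> [rho [dl [rho0 [dl0 fopt]]]] Df0 Tw; have [df [d2f _]] := f2.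
set D2 := 'D_d ('D_d f) xb.
have M0 : 0 <= enorm w + 1 by rewrite addr_ge0 // enorm_ge0.
have g0 := enorm_ge0 (grad f xb).
apply: (@ler_of_small _ (2 + enorm (grad f xb))); first by rewrite addr_ge0.
move=> e e0 e1.
have [del1 del1_0 h1] := expansion df d2f xb d theta0 M0 e0.
have [del2 del2_0 h2] := dir_nbhd_near d rho0 dl0 M0.
pose e' := Num.min del1 (Num.min del2 e).
have e'0 : 0 < e' by rewrite !lt_min del1_0 del2_0 e0.
have e'e : e' <= e by rewrite /e' !ge_min lexx !orbT.
have e'1 : e' <= del1 by rewrite /e' !ge_min lexx.
have e'2 : e' <= del2 by rewrite /e' !ge_min lexx !orbT.
have [t [r [w' [/andP[t0 te] /andP[r0 re] q ww' Cw']]]] := Tw _ e'0; clearbody e'.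
have w'M : enorm w' <= enorm w + 1.
  have := ler_enormD (w' - w) w; rewrite subrK => /le_trans; apply.
  by rewrite addrC lerD2l (le_trans (ltW ww')) // (le_trans e'e).
have tr0 : 0 < t * r by rewrite mulr_gt0.
have tre : `|t - theta * r| <= del1 * r.
  by apply: le_trans (Q_ratio (introT andP (conj t0 te)) r0 q) _; rewrite ler_pM2r.
have nb : dir_nbhd rho dl d (xb + t *: d + (2^-1 * t * r) *: w' - xb).
  rewrite -[xb + _ + _]addrA [xb + _]addrC addrK.
  exact: h2 (lt_le_trans te e'2) r0 (lt_le_trans re e'2) w'M.
have fge := fopt _ Cw' nb.
have := h1 t r w' t0 (lt_le_trans te e'1) r0 (lt_le_trans re e'1) tre w'M.
rewrite Df0 mulr0 subr0 ler_norml -/D2 => /andP[_ h3].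
have h4 : - (2 * e) <= 'D_w' f xb + theta * D2.
  rewrite -(ler_pM2l tr0); move: fge h3.
  by move: (f xb) (f _) ('D_w' f xb + _) => a b c; lra.
have h5 : 'D_w' f xb - 'D_w f xb <= enorm (grad f xb) * e.
  rewrite !derive_grad // -dotvBr; apply: le_trans (dotv_le _ _) _.
  by rewrite ler_wpM2l // (le_trans (ltW ww')).
by lra.
Qed.

(** Subregularity is applied at [xb + t *: d + (2^-1 * t * r) *: w], with the [t], [r] that realise
    [u]. Both distances scale with [t * r / 2], so dividing by it gives a bound valid for every [w],
    however large, with the same constant [kap]. *)
Lemma tangentQ_error_bound : MSCQ_dir g K xb d -> C !=set0 ->
  exists2 kap, 0 < kap & forall w u, tangentQ Q K (g xb) v u ->
    exists2 w', tangentQ Q C xb d w' & enorm (w' - w) <= kap * enorm (image w - u).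
Proof.
move=> [rho [dl [kap [rho0 [dl0 [kap0 mscq]]]]]] C0; exists kap => // w u Tu.
have [dg _] := g2.
have step e : 0 < e -> exists t r w', [/\ 0 < t < e, 0 < r < e, Q e t r,
    enorm (w' - w) <= kap * enorm (image w - u) + e &
    C (xb + t *: d + (2^-1 * t * r) *: w')].
  move=> e0; have M0 := enorm_ge0 w.
  have k4 : 0 < e / (4 * kap) by rewrite divr_gt0 // mulr_gt0.
  have [del1 del1_0 h1] := tangentQ_expansion M0 k4.
  have [del2 del2_0 h2] := dir_nbhd_near d rho0 dl0 M0.
  pose e' := Num.min del1 (Num.min del2 (Num.min e (e / (4 * kap)))).
  have e'0 : 0 < e' by rewrite !lt_min del1_0 del2_0 e0.
  have e'e : e' <= e by rewrite /e' !ge_min lexx !orbT.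
  have e'1 : e' <= del1 by rewrite /e' !ge_min lexx.
  have e'2 : e' <= del2 by rewrite /e' !ge_min lexx !orbT.
  have e'k : e' <= e / (4 * kap) by rewrite /e' !ge_min lexx !orbT.
  have [t [r [u' [te re q uu' Ku']]]] := Tu _ e'0; clearbody e'.
  have [/andP[t0 te'] /andP[r0 re']] := (te, re).
  have [a aw E] := h1 e' t r w e'1 te re q (lexx _).
  set x := xb + t *: d + (2^-1 * t * r) *: w in E.
  have nx : dir_nbhd rho dl d (x - xb).
    rewrite /x -[xb + _ + _]addrA [xb + _]addrC addrK.
    exact: h2 (lt_le_trans te' e'2) r0 (lt_le_trans re' e'2) (lexx _).
  have s0 : 0 < 2^-1 * t * r by rewrite !mulr_gt0 ?invr_gt0.
  have d1 : Defs.edist (g x) K <= 2^-1 * t * r * enorm (a - u').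
    apply: le_trans (edist_le _ Ku') _.
    by rewrite E opprD addrACA subrr add0r -scalerBr enormZ gtr0_norm.
  have au : enorm (a - u') <= enorm (image w - u) + 2 * (e / (4 * kap)).
    have := ler_enorm_dist (image w) a u'; have := ler_enorm_dist u (image w) u'.
    by rewrite (enorm_distC u u'); lra.
  (* The tolerance on the nearest point is of order [t * r], so that it becomes [e / 2] after
     rescaling. *)
  have se : 0 < 2^-1 * t * r * (e / 2) by rewrite mulr_gt0 // divr_gt0.
  have [x' Cx' xx'] := edist_near x C0 se.
  pose w' := w + (2^-1 * t * r)^-1 *: (x' - x).
  have x'E : xb + t *: d + (2^-1 * t * r) *: w' = x'.
    rewrite /w' scalerDr scalerA mulfV ?gt_eqF // scale1r addrA -/x.
    by rewrite addrC subrK.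
  exists t, r, w'; split.
  - by rewrite t0 (lt_le_trans te').
  - by rewrite r0 (lt_le_trans re').
  - exact: Q_mono q.
  - rewrite /w' addrAC subrr add0r enormZ gtr0_norm ?invr_gt0 //.
    rewrite ler_pdivrMl // enorm_distC; apply: le_trans (ltW xx') _.
    have ek : kap * (e / (4 * kap)) = e / 4 by field; rewrite gt_eqF.
    have m1 := mscq _ nx.
    have m2 := ler_wpM2l (ltW kap0) d1.
    have m3 : kap * (2^-1 * t * r * enorm (a - u')) <=
        2^-1 * t * r * (kap * enorm (image w - u) + e / 2).
      rewrite mulrCA ler_pM2l //; apply: le_trans (ler_wpM2l (ltW kap0) au) _.
      by rewrite mulrDr mulrCA ek; lra.
    rewrite -/C in m1; move: (2^-1 * t * r) se m2 m3 => s; lra.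
  - by rewrite x'E.
have /choice[trw htrw] : forall j : nat, exists trw : R * R * 'rV[R]_n,
    [/\ 0 < trw.1.1 < j.+1%:R^-1, 0 < trw.1.2 < j.+1%:R^-1,
     Q j.+1%:R^-1 trw.1.1 trw.1.2,
     enorm (trw.2 - w) <= kap * enorm (image w - u) + j.+1%:R^-1 &
     C (xb + trw.1.1 *: d + (2^-1 * trw.1.1 * trw.1.2) *: trw.2)].
  by move=> j; have [t [r [w' h]]] := step _ (harmonic_gt0 j); exists (t, r, w').
(* The rescaled points [w'] stay bounded, and a cluster point is tangent to [C] and inherits the
   estimate. *)
have [|w' clus] := @cluster_seq R n (fun j => (trw j).2)
   (enorm w + (kap * enorm (image w - u) + 1)).
  move=> j; have [_ _ _ h _] := htrw j.
  have := ler_enormD w ((trw j).2 - w); rewrite addrC subrK => /le_trans; apply.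
  by rewrite lerD2l (le_trans h) // lerD2l harmonic_le1.
exists w'.
  move=> e e0; have [N hN] := harmonic_lt e0; have [j Nj jw] := clus e N e0.
  have [/andP[t0 te] /andP[r0 re] q _ Cj] := htrw j; have je := hN j Nj.
  exists (trw j).1.1, (trw j).1.2, (trw j).2; split=> //.
  - by rewrite t0 (lt_trans te).
  - by rewrite r0 (lt_trans re).
  - by apply: Q_mono q; exact: ltW.
apply: (@ler_of_small _ 2) => // e e0 _.
have [N hN] := harmonic_lt e0; have [j Nj jw] := clus e N e0.
have [_ _ _ h _] := htrw j; have := hN j Nj.
have := ler_enorm_dist (trw j).2 w' w; rewrite (enorm_distC w' (trw j).2).
by move: (j.+1%:R^-1) h => z; lra.
Qed.

(** The abstract multiplier is used with [p] the gradient of [f], [G = 'd g xb], and the second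
    derivatives weighted by [theta] as [h] and [gam]. One [lam] serves all [B], because the
    approximating points [image w] lie in every admissible [B]. *)
Lemma directional_multiplier : closed K ->
  loc_opt_dir f g K xb d -> 'D_d f xb = 0 -> MSCQ_dir g K xb d -> C !=set0 ->
  tangentQ Q K (g xb) v !=set0 ->
  exists2 lam, mult_dir f g K xb d lam &
    forall B : set 'rV[R]_m, [set image w | w in tangentQ Q C xb d] `<=` B ->
      (lsupport (tangentQ Q K (g xb) v) B lam <=
        (theta * lagr ('D_d ('D_d f)) ('D_d ('D_d g)) lam xb)%:E)%E.
Proof.
move=> clK fopt Df0 mscq C0 T0; have [[df [d2f _]] [dg [d2g _]]] := (f2, g2).
have [kap kap0 eb] := tangentQ_error_bound mscq C0.
have imE w : 'd g xb w + theta *: 'D_d ('D_d g) xb = image w.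
  by rewrite /image (_ : 'D_w g xb = 'd g xb w) // deriveE.
have FS w : tangentQ Q C xb d w ->
    tangentQ Q K (g xb) v ('d g xb w + theta *: 'D_d ('D_d g) xb).
  by rewrite imE; exact: tangentQ_image.
have {}eb w u : tangentQ Q K (g xb) v u -> exists2 w', tangentQ Q C xb d w' &
    enorm (w' - w) <= kap * enorm ('d g xb w + theta *: 'D_d ('D_d g) xb - u).
  by rewrite imE; exact: eb.
have pos w : tangentQ Q C xb d w ->
    0 <= dotv (grad f xb) w + theta * 'D_d ('D_d f) xb.
  by rewrite -derive_grad //; exact: tangentQ_opt.
have clT := tangentQ_closed Q_mono (S := K) (y := g xb) (v := v).
have [lam [stat approx]] := exists_multiplier clT kap0 FS eb pos T0.
exists lam.
  split; last first.
    by move=> z; rewrite derive_lagr // /lagr derive_grad // deriveE.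
  apply: (dir_normal_of_lim_normal Q_mono clK) => e /approx[w [lam' [_ nl le _]]].
  by exists ('d g xb w + theta *: 'D_d ('D_d g) xb), lam'.
move=> B imB; rewrite /lsupport; case: pselect => [T00|_]; first exact: leNye.
apply: ge_ereal_sup => _ [del /= del0 <-].
set h := 'D_d ('D_d g) xb; set c := theta * _.
apply/lee_addgt0Pr => e e0.
(* The first entry puts [lam'] in the ball of the lower limit; the second keeps the change of
   [dotv lam' (theta *: h)] below [e]. *)
pose e' := Num.min del (e / (theta * enorm h + 1)).
have b0 : 0 < theta * enorm h + 1 by rewrite ltr_wpDl // mulr_ge0 // enorm_ge0.
have e'0 : 0 < e' by rewrite lt_min del0 divr_gt0.
have [w [lam' [Tw nl le lle]]] := approx _ e'0.
apply: (@le_trans _ _ (inner_inf (tangentQ Q K (g xb) v) B lam')).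
  apply: ereal_inf_lbound; exists lam' => //=.
  by apply: lt_le_trans le _; rewrite /e' ge_min lexx.
apply: (@le_trans _ _ (dotv lam' (image w))%:E).
  apply: ereal_inf_lbound; exists (image w) => //; split; last by rewrite /= -imE.
  by apply: imB; exists w.
rewrite -EFinD lee_fin -imE; apply: le_trans lle _.
rewrite /c /lagr -/h mulrDr -dotvZr -addrA lerD2l -lerBlDl -dotvBl.
apply: le_trans (dotv_le _ _) _; rewrite enormZ ger0_norm //.
have : e' * (theta * enorm h + 1) <= e by rewrite -ler_pdivlMr // /e' ge_min lexx orbT.
have : 0 <= theta * enorm h by rewrite mulr_ge0 // enorm_ge0.
have := enorm_ge0 (lam' - lam); clearbody e'; move: (theta * enorm h) => b; nra.
Qed.

End Constraint.

(** * Sequential and quantitative forms of the two tangent sets *)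

Section TangentSets.
Context {R : realType} {k : nat}.
Implicit Types (S : set 'rV[R]_k) (y v w : 'rV[R]_k).

Lemma tangent2E S y v : tangent2 S y v = tangentQ (fun _ t r => t = r) S y v.
Proof.
apply/seteqP; split=> w.
  move=> [t [wk [t0 [tl [wl Sw]]]]] e e0.
  have [N1 h1] := cvg_real_near tl e0; have [N2 h2] := cvg_enorm_near wl e0.
  pose N := maxn N1 N2; exists (t N), (t N), (wk N).
  have := h1 N (leq_maxl _ _); rewrite subr0 gtr0_norm // => te.
  rewrite t0 te; split=> //; first exact: h2 (leq_maxr _ _).
  by rewrite -mulrA -expr2.
move=> H; have /choice[tw htw] : forall j : nat, exists tw : R * 'rV[R]_k,
    [/\ 0 < tw.1 < j.+1%:R^-1, enorm (tw.2 - w) < j.+1%:R^-1 &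
     S (y + tw.1 *: v + (2^-1 * tw.1 ^+ 2) *: tw.2)].
  move=> j; have [t [r [w' [te _ <- ww' Sw]]]] := H _ (harmonic_gt0 j).
  by exists (t, w'); split=> //; rewrite expr2 mulrA.
exists (fun j => (tw j).1), (fun j => (tw j).2); split; [|split; [|split]].
- by move=> j; have [/andP[]] := htw j.
- apply: cvg_real_harmonic => j; have [/andP[t0 tj] _ _] := htw j.
  by rewrite subr0 gtr0_norm // ltW.
- by apply: cvg_enorm_harmonic => j; have [_ /ltW] := htw j.
- by move=> j; have [] := htw j.
Qed.

Lemma tangent2asymE S y v :
  tangent2asym S y v = tangentQ (fun e t r => t / r < e) S y v.
Proof.
apply/seteqP; split=> w.
  move=> [t [r [wk [t0 [r0 [tl [rl [trl [wl Sw]]]]]]]]] e e0.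
  have [N1 h1] := cvg_real_near tl e0; have [N2 h2] := cvg_real_near rl e0.
  have [N3 h3] := cvg_real_near trl e0; have [N4 h4] := cvg_enorm_near wl e0.
  pose N := (N1 + N2 + N3 + N4)%N.
  have le1 : (N1 <= N)%N by rewrite /N -!addnA leq_addr.
  have le2 : (N2 <= N)%N by rewrite /N -!addnA addnCA leq_addr.
  have le3 : (N3 <= N)%N by rewrite /N addnAC leq_addl.
  have le4 : (N4 <= N)%N by rewrite /N leq_addl.
  exists (t N), (r N), (wk N).
  have := h1 N le1; rewrite subr0 gtr0_norm // => te.
  have := h2 N le2; rewrite subr0 gtr0_norm // => re.
  have := h3 N le3; rewrite subr0 gtr0_norm ?divr_gt0 // => tre.
  by rewrite t0 te r0 re; split=> //; exact: h4.
move=> H; have /choice[f hf] : forall j : nat, exists f : R * R * 'rV[R]_k,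
    [/\ 0 < f.1.1 < j.+1%:R^-1, 0 < f.1.2 < j.+1%:R^-1, f.1.1 / f.1.2 < j.+1%:R^-1,
     enorm (f.2 - w) < j.+1%:R^-1 &
     S (y + f.1.1 *: v + (2^-1 * f.1.1 * f.1.2) *: f.2)].
  by move=> j; have [t [r [w' h]]] := H _ (harmonic_gt0 j); exists (t, r, w').
have t0 j : 0 < (f j).1.1 by have [/andP[]] := hf j.
have r0 j : 0 < (f j).1.2 by have [_ /andP[]] := hf j.
exists (fun j => (f j).1.1), (fun j => (f j).1.2), (fun j => (f j).2).
split=> //; split=> //; split; [|split; [|split; [|split]]].
- apply: cvg_real_harmonic => j; have [/andP[_ tj] _ _ _ _] := hf j.
  by rewrite subr0 gtr0_norm // ltW.
- apply: cvg_real_harmonic => j; have [_ /andP[_ rj] _ _ _] := hf j.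
  by rewrite subr0 gtr0_norm // ltW.
- apply: cvg_real_harmonic => j; have [_ _ trj _ _] := hf j.
  by rewrite subr0 gtr0_norm ?divr_gt0 // ltW.
- by apply: cvg_enorm_harmonic => j; have [_ _ _ /ltW] := hf j.
- by move=> j; have [] := hf j.
Qed.

(** Write [t *: dk = t *: d + (t * r / 2) *: w] with [w = 2 * (dk - d) / r]. For fixed [r], a late
    index makes both [t / r] and [w] small. This supplies the nonempty tangent set of the first
    assertion. *)
Lemma tangent2asym0 S x d : tangent_cone S x d -> tangent2asym S x d 0.
Proof.
move=> [t [dk [t0 [tl [dl Sd]]]]]; rewrite tangent2asymE => e e0.
pose r := e / 2; have r0 : 0 < r by rewrite divr_gt0.
have re : r < e by rewrite ltr_pdivrMr // ltr_pMr // ltr1n.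
have er0 : 0 < Num.min e (e * r) by rewrite lt_min e0 mulr_gt0.
have er1 : 0 < e * (2^-1 * r) by rewrite !mulr_gt0 ?invr_gt0.
have [N1 h1] := cvg_real_near tl er0; have [N2 h2] := cvg_enorm_near dl er1.
pose N := maxn N1 N2.
have := h1 N (leq_maxl _ _); rewrite subr0 gtr0_norm // lt_min => /andP[te ter].
have s0 : 0 < 2^-1 * r by rewrite mulr_gt0 ?invr_gt0.
exists (t N), r, ((2^-1 * r)^-1 *: (dk N - d)); split=> //.
- by rewrite t0.
- by rewrite r0.
- by rewrite ltr_pdivrMr.
- rewrite subr0 enormZ gtr0_norm ?invr_gt0 // ltr_pdivrMl // mulrC.
  exact: h2 (leq_maxr _ _).
- rewrite scalerA (_ : 2^-1 * t N * r * (2^-1 * r)^-1 = t N); last first.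
    by field; rewrite gt_eqF.
  by rewrite -addrA -scalerDr [d + _]addrC subrK.
Qed.

End TangentSets.

(** * Assembly of the two second-order conditions *)

Lemma derive2_lagr {R : realType} {n m : nat} (f : 'rV[R]_n -> R)
    (g : 'rV[R]_n -> 'rV[R]_m) lam d x : C2R f -> C2 g ->
  'D_d ('D_d (lagr f g lam)) x = lagr ('D_d ('D_d f)) ('D_d ('D_d g)) lam x.
Proof.
move=> [df [d2f _]] [dg [d2g _]].
have -> : 'D_d (lagr f g lam) = lagr ('D_d f) ('D_d g) lam.
  by apply/funext => y; exact: derive_lagr.
exact: derive_lagr.
Qed.

Theorem theorem4p7 (R : realType) (n m : nat)
  (f : 'rV[R]_n -> R) (g : 'rV[R]_n -> 'rV[R]_m) (K : set 'rV[R]_m)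
  (xb d : 'rV[R]_n) :
  C2R f -> C2 g -> closed K ->
  tangent_cone (g @^-1` K) xb d ->
  loc_opt_dir f g K xb d ->
  'D_d f xb = 0 ->
  MSCQ_dir g K xb d ->
  let C := g @^-1` K in
  let v := 'D_d g xb in
  let Theta := [set 'D_w g xb | w in tangent2asym C xb d] in
  let Omega := [set 'D_w g xb + 'D_d ('D_d g) xb | w in tangent2 C xb d] in
  (exists2 lam, mult_dir f g K xb d lam &
     (forall A : set 'rV[R]_m, Theta `<=` A ->
        (lsupport (tangent2asym K (g xb) v) A lam <= 0)%E) /\
     (lsupport0 (tangent2asym K (g xb) v) lam <= 0)%E) /\
  (tangent2 K (g xb) v !=set0 ->
   exists2 lam, mult_dir f g K xb d lam &
     (forall B : set 'rV[R]_m, Omega `<=` B ->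
        (0 <= ('D_d ('D_d (lagr f g lam)) xb)%:E
                - lsupport (tangent2 K (g xb) v) B lam)%E) /\
     (0 <= ('D_d ('D_d (lagr f g lam)) xb)%:E
                - lsupport0 (tangent2 K (g xb) v) lam)%E).
Proof.
move=> f2 g2 clK Td fopt Df0 mscq C v Theta Omega.
have C0 : C !=set0.
  case: Td => t [dk [_ [_ [_ Cx]]]]; exists (xb + t 0%N *: dk 0%N); exact: Cx.
split.
  (* The first assertion is the case [theta = 0], where all second derivatives disappear from the
     bound. *)
  pose Q (e t r : R) := t / r < e.
  have Q_mono e e' t r : e <= e' -> Q e t r -> Q e' t r.
    by move=> ee' /lt_le_trans; apply.
  have Q_ratio e t r : 0 < t < e -> 0 < r -> Q e t r -> `|t - 0 * r| <= e * r.
    move=> /andP[t0 _] r0 /ltW; rewrite ler_pdivrMr // mul0r subr0.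
    by rewrite gtr0_norm.
  have T0 : tangentQ Q K (g xb) v !=set0.
    exists ('D_0 g xb + 0 *: 'D_d ('D_d g) xb).
    apply: (tangentQ_image Q_mono (lexx 0) Q_ratio g2).
    by rewrite -tangent2asymE; exact: tangent2asym0.
  have [lam mlam sup] :=
    directional_multiplier Q_mono (lexx 0) Q_ratio f2 g2 clK fopt Df0 mscq C0 T0.
  have sup0 A : Theta `<=` A -> (lsupport (tangent2asym K (g xb) v) A lam <= 0)%E.
    move=> ThA; rewrite tangent2asymE.
    apply: le_trans (sup A _) _; last by rewrite mul0r.
    move=> _ [w Tw <-]; apply: ThA; exists w; first by rewrite tangent2asymE.
    by rewrite scale0r addr0.
  by exists lam => //; split=> [A|]; apply: sup0.
(* The second assertion is the case [r = t], hence [theta = 1]. *)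
move=> T0; pose Q (e t r : R) := t = r.
have Q_mono e e' t r : e <= e' -> Q e t r -> Q e' t r by [].
have Q_ratio e t r : 0 < t < e -> 0 < r -> Q e t r -> `|t - 1 * r| <= e * r.
  move=> /andP[t0 te] r0 ->; rewrite mul1r subrr normr0 mulr_ge0 ?(ltW r0) //.
  exact: ltW (lt_trans t0 te).
rewrite tangent2E in T0.
have [lam mlam sup] :=
  directional_multiplier Q_mono ler01 Q_ratio f2 g2 clK fopt Df0 mscq C0 T0.
have sup0 B : Omega `<=` B -> (0 <= ('D_d ('D_d (lagr f g lam)) xb)%:E
    - lsupport (tangent2 K (g xb) v) B lam)%E.
  (* The second derivative is finite, so the difference can be compared with zero even when the
     support value is infinite. *)
  move=> OmB; rewrite sube_ge0 ?orbT // tangent2E derive2_lagr //.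
  apply: le_trans (sup B _) _; last by rewrite mul1r.
  move=> _ [w Tw <-]; apply: OmB; exists w; first by rewrite tangent2E.
  by rewrite scale1r.
by exists lam => //; split=> [A|]; apply: sup0.
Qed.
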